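(* Let $K$ be a polygonal knot and let $0<r<R(K)$. Then $Tube(K,r)$ is an embedded torus.
   Context: A polygonal knot $K$ with $n$ edges is given by distinct vertices $v_1,\dots,v_n\in\mathbb{R}^3$ (indices mod $n$), with edges $e_i=[v_i,v_{i+1}]$ meeting only at the common vertex of adjacent edges. $Tube(e_i,r)$ is the union of the closed balls of radius $r$ centered at the points of $e_i$, and $Tube(K,r)=\bigcup_i Tube(e_i,r)$ (here ''embedded torus'' means an embedded solid torus with $K$ as its core). $angle(v_i)\in[0,\pi)$ is the turning angle at $v_i$ (angle between $v_i-v_{i-1}$ and $v_{i+1}-v_i$); $Rad(v_i)=\dfrac{\min\{|e_{i-1}|,|e_i|\}}{2\tan(angle(v_i)/2)}$, $MinRad(K)=\min_i Rad(v_i)$. For $x\in K$, $d_x(y)=\Vert x-y\Vert$; $y$ is a turning point for $x$ if moving along the knot $d_x$ changes from increasing to decreasing or vice versa at $y$. $DC(K)$ is the set of pairs $(x,y)$, $x\neq y$, with $x$ a turning point of $d_y$ and $y$ a turning point of $d_x$; $dcsd(K)=\min\{\Vert x-y\Vert:(x,y)\in DC(K)\}$; the polygonal thickness radius is $R(K)=\min\{MinRad(K),dcsd(K)/2\}$. *)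

(* Defs.v *)
From Stdlib Require Import Reals Lra Lia List.
From Stdlib Require Import Ratan.
From Coquelicot Require Import Coquelicot.
Open Scope R_scope.

Definition pt3 := (R * R * R)%type.

Definition padd (p q : pt3) : pt3 :=
  let '(a1, a2, a3) := p in let '(b1, b2, b3) := q in (a1 + b1, a2 + b2, a3 + b3).
Definition pscal (t : R) (p : pt3) : pt3 :=
  let '(a1, a2, a3) := p in (t * a1, t * a2, t * a3).
Definition psub (p q : pt3) : pt3 := padd p (pscal (-1) q).
Definition pdot (p q : pt3) : R :=
  let '(a1, a2, a3) := p in let '(b1, b2, b3) := q in a1 * b1 + a2 * b2 + a3 * b3.
Definition pnorm (p : pt3) : R := sqrt (pdot p p).
Definition pdist (p q : pt3) : R := pnorm (psub p q).

Definition on_seg (a b p : pt3) : Prop :=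
  exists t, 0 <= t <= 1 /\ p = padd (pscal (1 - t) a) (pscal t b).

Record polyknot := PolyKnot {
  pk_n : nat;
  pk_v : nat -> pt3
}.

Definition vtx (K : polyknot) (i : nat) : pt3 := pk_v K (i mod pk_n K).
Definition on_edge (K : polyknot) (i : nat) (p : pt3) : Prop :=
  on_seg (vtx K i) (vtx K (S i)) p.
Definition on_knot (K : polyknot) (p : pt3) : Prop :=
  exists i, (i < pk_n K)%nat /\ on_edge K i p.

Definition is_polyknot (K : polyknot) : Prop :=
  (3 <= pk_n K)%nat /\
  (forall i j, (i < pk_n K)%nat -> (j < pk_n K)%nat -> i <> j -> vtx K i <> vtx K j) /\
  (forall i j p, (i < pk_n K)%nat -> (j < pk_n K)%nat -> i <> j ->
     on_edge K i p -> on_edge K j p ->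
     (j = (S i) mod pk_n K /\ p = vtx K (S i)) \/
     (i = (S j) mod pk_n K /\ p = vtx K (S j))).

Definition Tube_edge (K : polyknot) (i : nat) (r : R) (p : pt3) : Prop :=
  exists q, on_edge K i q /\ pdist p q <= r.
Definition Tube (K : polyknot) (r : R) (p : pt3) : Prop :=
  exists i, (i < pk_n K)%nat /\ Tube_edge K i r p.

Definition prev_idx (K : polyknot) (i : nat) : nat := (i + pk_n K - 1)%nat.
Definition angle_at (K : polyknot) (i : nat) : R :=
  let a := psub (vtx K i) (vtx K (prev_idx K i)) in
  let b := psub (vtx K (S i)) (vtx K i) in
  acos (pdot a b / (pnorm a * pnorm b)).

Definition Rad (K : polyknot) (i : nat) : Rbar :=
  if Req_EM_T (angle_at K i) 0 then p_infty
  else Finite (Rmin (pdist (vtx K (prev_idx K i)) (vtx K i))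
                    (pdist (vtx K i) (vtx K (S i)))
               / (2 * tan (angle_at K i / 2))).

Definition MinRad (K : polyknot) : Rbar :=
  fold_right Rbar_min p_infty (map (Rad K) (seq 0 (pk_n K))).

Definition kparam (K : polyknot) (s : R) : pt3 :=
  let k := Int_part s in
  let t := s - IZR k in
  let i := Z.to_nat (Z.modulo k (Z.of_nat (pk_n K))) in
  padd (pscal (1 - t) (vtx K i)) (pscal t (vtx K (S i))).

Definition turning_point (K : polyknot) (x y : pt3) : Prop :=
  exists s delta, kparam K s = y /\ 0 < delta /\
   ((forall u w, s - delta <= u -> u < w -> w <= s ->
        pdist x (kparam K u) < pdist x (kparam K w)) /\
    (forall u w, s <= u -> u < w -> w <= s + delta ->
        pdist x (kparam K w) < pdist x (kparam K u))
    \/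
    (forall u w, s - delta <= u -> u < w -> w <= s ->
        pdist x (kparam K w) < pdist x (kparam K u)) /\
    (forall u w, s <= u -> u < w -> w <= s + delta ->
        pdist x (kparam K u) < pdist x (kparam K w))).

Definition DC (K : polyknot) (x y : pt3) : Prop :=
  on_knot K x /\ on_knot K y /\ x <> y /\ turning_point K y x /\ turning_point K x y.

(* dcsd(K) = min { |x - y| : (x,y) in DC(K) } (taken as an infimum in Rbar; +oo if empty) *)
Definition dcsd (K : polyknot) : Rbar :=
  Glb_Rbar (fun d => exists x y, DC K x y /\ d = pdist x y).

Definition thick_R (K : polyknot) : Rbar :=
  Rbar_min (MinRad K) (Rbar_mult (Finite (/ 2)) (dcsd K)).

(* Embedded solid torus with core K: image of a topological embedding of
   S^1 x D^2 = {(a,b,c,d) in R^4 | a^2+b^2 = 1, c^2+d^2 <= 1}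
   (compact, so a continuous injection is an embedding), sending the core
   circle S^1 x {0} onto K. *)
Definition pt4 := (R * R * R * R)%type.
Definition in_solid_torus (p : pt4) : Prop :=
  let '(a, b, c, d) := p in a * a + b * b = 1 /\ c * c + d * d <= 1.
Definition dist4 (p q : pt4) : R :=
  let '(a1, a2, a3, a4) := p in let '(b1, b2, b3, b4) := q in
  sqrt ((a1 - b1)^2 + (a2 - b2)^2 + (a3 - b3)^2 + (a4 - b4)^2).

Definition embedded_torus_with_core (X : pt3 -> Prop) (C : pt3 -> Prop) : Prop :=
  exists f : pt4 -> pt3,
    (forall p, in_solid_torus p -> forall eps, 0 < eps -> exists del, 0 < del /\
        forall q, in_solid_torus q -> dist4 p q < del -> pdist (f p) (f q) < eps) /\
    (forall p q, in_solid_torus p -> in_solid_torus q -> f p = f q -> p = q) /\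
    (forall y, X y <-> exists p, in_solid_torus p /\ f p = y) /\
    (forall y, C y <-> exists a b, a * a + b * b = 1 /\ f (a, b, 0, 0) = y).

(* Main.v *)
(** Each edge of the knot carries the piece of its tube lying between the two mitre planes (the planes
bisecting the turn) at its end points.  Reflection in a mitre plane exchanges the directions of the two
adjacent edges, so consecutive pieces are glued along their common mitre section, and [r < MinRad K] says
precisely that the two mitre planes of an edge do not meet inside the tube of that edge; the pencil of planes
they span then slices the piece into discs that are star-shaped around the edge.

Two pieces that are not consecutive are disjoint: otherwise take a point [p] common to two such pieces for
which the larger of the distances to the two edges is minimal.  By minimality no point close to [p] is nearer
to both edges, which forces [p] to be the midpoint of its nearest points [x] and [y] on the two edges and
makes [y] a local minimum of the distance to [x] along the knot, and vice versa.  Hence [(x, y)] belongs to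
[DC K] although [pdist x y <= 2 * r < dcsd K].

The solid torus is parametrized by the slice (first circle coordinate), the direction inside the slice and
the distance to the edge.  This relation is closed and is a bijection with the compact set [Tube K r], so its
inverse is continuous. *)
Require Import Defs.
From Stdlib Require Import Reals Lra Lia Psatz ZArith Arith List Classical ClassicalEpsilon.
From Coquelicot Require Import Coquelicot.
Open Scope R_scope.

(** * Vectors and segments *)

(** The slices are oblique, and near a vertex they also meet the rounded end of the tube of the
    edge, so the distance to the edge has no simple formula on them. What replaces one is its
    convexity: along a ray leaving the core it starts at 0 and grows at least linearly, so each
    radius is reached exactly once.

    Directions inside the slices need a frame that closes up after one turn around the knot. A
    single vector [w] provides it: in the slice with normal N the coordinates are the dot products
    with [w] and with the cross product of [w] and N. They depend only on N, hence agree on a mitre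
    section shared by two pieces. The normals belonging to one edge stay in one plane through the
    origin, so [w] only has to avoid n planes.

    In the disjointness argument a point moved slightly away from [p] may leave the two pieces under
    consideration. It then enters a neighbouring piece that also contains [p]. Since three
    consecutive pieces have no common point, the pair obtained in this way is again not consecutive.
    This is why minimality is taken over all such pairs and not over one fixed pair. *)

Definition pcross (p q : pt3) : pt3 :=
  let '(a1, a2, a3) := p in let '(b1, b2, b3) := q in
  (a2 * b3 - a3 * b2, a3 * b1 - a1 * b3, a1 * b2 - a2 * b1).

Ltac coords :=
  repeat match goal with
    | p : pt3 |- _ => destruct p as [[? ?] ?]
    | p : (R * R * R)%type |- _ => destruct p as [[? ?] ?]
  end;
  unfold psub, padd, pscal, pdot, pcross in *; simpl in *.

Ltac split_pairs :=
  repeat match goal with |- (_, _) = (_, _) => apply f_equal2 end.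

Ltac vec_eq :=
  intros;
  repeat match goal with |- context [vtx ?K ?i] => generalize (vtx K i); intro end;
  coords; split_pairs; ring.

Lemma pdot_comm p q : pdot p q = pdot q p.
Proof. vec_eq. Qed.

Lemma pdot_padd_l p q z : pdot (padd p q) z = pdot p z + pdot q z.
Proof. vec_eq. Qed.

Lemma pdot_padd_r p q z : pdot z (padd p q) = pdot z p + pdot z q.
Proof. vec_eq. Qed.

Lemma pdot_pscal_l t p z : pdot (pscal t p) z = t * pdot p z.
Proof. vec_eq. Qed.

Lemma pdot_pscal_r t p z : pdot z (pscal t p) = t * pdot z p.
Proof. vec_eq. Qed.

Lemma pdot_psub_l p q z : pdot (psub p q) z = pdot p z - pdot q z.
Proof. vec_eq. Qed.

Lemma pdot_psub_r p q z : pdot z (psub p q) = pdot z p - pdot z q.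
Proof. vec_eq. Qed.

Ltac expand_dot :=
  rewrite ?pdot_pscal_l, ?pdot_pscal_r, ?pdot_padd_l, ?pdot_padd_r, ?pdot_psub_l, ?pdot_psub_r,
    ?pdot_pscal_l, ?pdot_pscal_r.

Lemma pdot_self_ge0 p : 0 <= pdot p p.
Proof. coords; nra. Qed.

Lemma pdot_self_eq0 p : pdot p p = 0 -> p = (0, 0, 0).
Proof.
  coords; intros H; split_pairs; nra.
Qed.

Lemma pnorm_ge0 p : 0 <= pnorm p.
Proof. apply sqrt_pos. Qed.

Lemma pnorm_sqr p : pnorm p * pnorm p = pdot p p.
Proof. apply sqrt_sqrt, pdot_self_ge0. Qed.

Lemma pnorm_eq0 p : pnorm p = 0 -> p = (0, 0, 0).
Proof. intros H; apply pdot_self_eq0; rewrite <- pnorm_sqr, H; ring. Qed.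

Lemma pnorm_gt0 p : p <> (0, 0, 0) -> 0 < pnorm p.
Proof.
  intros H; destruct (pnorm_ge0 p) as [|E]; auto.
  exfalso; apply H, pnorm_eq0; auto.
Qed.

Lemma lagrange_identity p q :
  pdot (pcross p q) (pcross p q) = pdot p p * pdot q q - pdot p q * pdot p q.
Proof. vec_eq. Qed.

Lemma cauchy_schwarz p q : Rabs (pdot p q) <= pnorm p * pnorm q.
Proof.
  apply Rsqr_incr_0_var; [|apply Rmult_le_pos; apply pnorm_ge0].
  rewrite <- Rsqr_abs; unfold Rsqr.
  replace (pnorm p * pnorm q * (pnorm p * pnorm q))
    with (pnorm p * pnorm p * (pnorm q * pnorm q)) by ring.
  rewrite !pnorm_sqr.
  pose proof (lagrange_identity p q); pose proof (pdot_self_ge0 (pcross p q)); lra.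
Qed.

Lemma pdot_le p q : pdot p q <= pnorm p * pnorm q.
Proof. eapply Rle_trans; [apply Rle_abs|apply cauchy_schwarz]. Qed.

Lemma pdot_ge p q : - (pnorm p * pnorm q) <= pdot p q.
Proof.
  pose proof (cauchy_schwarz p q); pose proof (Rle_abs (- pdot p q)).
  rewrite Rabs_Ropp in *; lra.
Qed.

Lemma pnorm_le_of_sqr p x : 0 <= x -> pdot p p <= x * x -> pnorm p <= x.
Proof.
  intros Hx H; rewrite <- pnorm_sqr in H; pose proof (pnorm_ge0 p); nra.
Qed.

Lemma pnorm_padd p q : pnorm (padd p q) <= pnorm p + pnorm q.
Proof.
  pose proof (pnorm_ge0 p); pose proof (pnorm_ge0 q).
  apply pnorm_le_of_sqr; [lra|].
  expand_dot; rewrite (pdot_comm q p).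
  pose proof (pdot_le p q); rewrite <- !pnorm_sqr; nra.
Qed.

Lemma pnorm_pscal t p : pnorm (pscal t p) = Rabs t * pnorm p.
Proof.
  unfold pnorm; expand_dot.
  replace (t * (t * pdot p p)) with (t * t * pdot p p) by ring.
  rewrite sqrt_mult_alt by nra.
  now rewrite <- (sqrt_Rsqr_abs t).
Qed.

Lemma pdist_ge0 p q : 0 <= pdist p q.
Proof. apply pnorm_ge0. Qed.

Lemma pdist_sqr p q : pdist p q * pdist p q = pdot (psub p q) (psub p q).
Proof. apply pnorm_sqr. Qed.

Lemma pdist_sym p q : pdist p q = pdist q p.
Proof. unfold pdist, pnorm; f_equal; vec_eq. Qed.

Lemma pdist_self p : pdist p p = 0.
Proof.
  unfold pdist, pnorm; replace (pdot _ _) with 0 by vec_eq; apply sqrt_0.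
Qed.

Lemma psub_eq0 p q : psub p q = (0, 0, 0) -> p = q.
Proof.
  coords; intros H; injection H; intros; split_pairs; lra.
Qed.

Lemma pdist_eq0 p q : pdist p q = 0 -> p = q.
Proof. intros H; apply psub_eq0, pnorm_eq0, H. Qed.

Lemma pdist_triangle p q z : pdist p z <= pdist p q + pdist q z.
Proof.
  unfold pdist; replace (psub p z) with (padd (psub p q) (psub q z)) by vec_eq.
  apply pnorm_padd.
Qed.

Lemma pdist_convex a b x y t : 0 <= t <= 1 ->
  pdist (padd (pscal (1 - t) a) (pscal t b)) (padd (pscal (1 - t) x) (pscal t y))
  <= (1 - t) * pdist a x + t * pdist b y.
Proof.
  intros Ht; unfold pdist.
  replace (psub _ _) with (padd (pscal (1 - t) (psub a x)) (pscal t (psub b y)))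
    by vec_eq.
  eapply Rle_trans; [apply pnorm_padd|].
  rewrite !pnorm_pscal, !Rabs_pos_eq; lra.
Qed.

Lemma pdist_lt_of_sqr p q x y :
  pdot (psub p q) (psub p q) < pdot (psub x y) (psub x y) -> pdist p q < pdist x y.
Proof.
  rewrite <- !pdist_sqr; pose proof (pdist_ge0 p q); pose proof (pdist_ge0 x y); nra.
Qed.

Lemma pdist_le_of_sqr p q x y :
  pdot (psub p q) (psub p q) <= pdot (psub x y) (psub x y) -> pdist p q <= pdist x y.
Proof.
  rewrite <- !pdist_sqr; pose proof (pdist_ge0 p q); pose proof (pdist_ge0 x y); nra.
Qed.

Lemma pdot_sub_le p q z : pdot p z - pdot q z <= pdist p q * pnorm z.
Proof. rewrite <- pdot_psub_l; apply pdot_le. Qed.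

Definition seg_pt (a d : pt3) (t : R) : pt3 := padd a (pscal t d).

Lemma on_seg_seg_pt a b p :
  on_seg a b p <-> exists t, 0 <= t <= 1 /\ p = seg_pt a (psub b a) t.
Proof.
  split; intros (t & Ht & ->); exists t; split; auto; unfold seg_pt; vec_eq.
Qed.

(** The squared distance from [x] along the ray is a quadratic in t with nonnegative slope at 0 and
    positive leading coefficient. This supplies the strict monotonicity that [turning_point] asks
    for. *)
Lemma seg_pt_pdist_lt x y e t1 t2 :
  e <> (0, 0, 0) -> pdot (psub x y) e <= 0 -> 0 <= t1 < t2 ->
  pdist x (seg_pt y e t1) < pdist x (seg_pt y e t2).
Proof.
  intros He H Ht; apply pdist_lt_of_sqr; unfold seg_pt.
  replace (pdot (psub x (padd y (pscal t1 e))) (psub x (padd y (pscal t1 e))))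
    with (pdot (psub x y) (psub x y) - 2 * t1 * pdot (psub x y) e + t1 * t1 * pdot e e)
    by vec_eq.
  replace (pdot (psub x (padd y (pscal t2 e))) (psub x (padd y (pscal t2 e))))
    with (pdot (psub x y) (psub x y) - 2 * t2 * pdot (psub x y) e + t2 * t2 * pdot e e)
    by vec_eq.
  pose proof (pdot_self_ge0 e).
  assert (pdot e e <> 0) by (intros E; apply He, pdot_self_eq0, E).
  assert (0 < (t2 * t2 - t1 * t1) * pdot e e) by (apply Rmult_lt_0_compat; nra).
  nra.
Qed.

(** First-order condition at a minimum: with a positive dot product a short step along [e] would
    come closer to [p]. *)
Lemma nearest_pdot_le p x e b : 0 < b ->
  (forall t, 0 <= t <= b -> pdist p x <= pdist p (seg_pt x e t)) ->
  pdot (psub p x) e <= 0.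
Proof.
  intros Hb H; apply Rnot_lt_le; intros Hc.
  pose proof (pdot_self_ge0 e) as He.
  set (c := pdot (psub p x) e) in *; set (m := pdot e e) in *.
  assert (Hm : 0 < m + 1) by lra.
  (* Small enough that the gain 2tc outweighs the quadratic term t^2 m; [m + 1] keeps the quotient
     defined when [e] vanishes. *)
  set (t := Rmin b (c / (m + 1))).
  assert (Ht : 0 < t).
  { apply Rmin_glb_lt; [lra|]; apply Rdiv_lt_0_compat; lra. }
  assert (Ht2 : t * (m + 1) <= c).
  { apply Rle_trans with (c / (m + 1) * (m + 1)); [|right; field; lra].
    apply Rmult_le_compat_r; [lra|apply Rmin_r]. }
  assert (Htb : t <= b) by apply Rmin_l.
  specialize (H t (conj (Rlt_le _ _ Ht) Htb)).
  assert (Hlt : pdist p (seg_pt x e t) < pdist p x); [|lra].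
  apply pdist_lt_of_sqr; unfold seg_pt.
  replace (pdot (psub p (padd x (pscal t e))) (psub p (padd x (pscal t e))))
    with (pdot (psub p x) (psub p x) - 2 * t * c + t * t * m)
    by (unfold c, m; vec_eq).
  nra.
Qed.

(** * Distance to a segment and sequential compactness *)

(** The squared distance is a quadratic in t with vertex [b / m]; its minimum on [0,1] is at the
    vertex clamped to that interval. *)
Lemma segment_min_exists p a d :
  exists t, 0 <= t <= 1 /\
    forall t', 0 <= t' <= 1 -> pdist p (seg_pt a d t) <= pdist p (seg_pt a d t').
Proof.
  set (b := pdot (psub p a) d); set (m := pdot d d).
  assert (Hm : 0 <= m) by apply pdot_self_ge0.
  assert (Hq : forall t, pdot (psub p (seg_pt a d t)) (psub p (seg_pt a d t)) =
    pdot (psub p a) (psub p a) - 2 * t * b + t * t * m)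
    by (intros t; unfold b, m, seg_pt; vec_eq).
  destruct Hm as [Hm|Hm].
  - assert (Hbm : b = b / m * m) by (field; lra).
    set (c := b / m) in *.
    exists (Rmax 0 (Rmin 1 c)); split.
    + unfold Rmax, Rmin; repeat destruct Rle_dec; lra.
    + intros t' Ht'; apply pdist_le_of_sqr; rewrite !Hq, Hbm.
      (* The difference of the two values of the quadratic, factored. *)
      cut (0 <= m * ((t' - Rmax 0 (Rmin 1 c)) * (t' + Rmax 0 (Rmin 1 c) - 2 * c)));
        [lra|].
      apply Rmult_le_pos; [lra|]; generalize c; clear - Ht'; intros c.
      unfold Rmax, Rmin; destruct (Rle_dec 1 c) as [|?%Rnot_le_lt];
        destruct Rle_dec as [|?%Rnot_le_lt];
        try lra; try nra.
      replace (_ * _) with ((t' - c) * (t' - c)) by ring; apply Rle_0_sqr.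
  - assert (Hd : d = (0, 0, 0)) by (apply pdot_self_eq0; fold m; lra).
    exists 0; split; [lra|]; intros t' _; right; f_equal.
    unfold seg_pt; rewrite Hd; vec_eq.
Qed.

Lemma foot_sig p a b :
  {q | on_seg a b q /\ forall q', on_seg a b q' -> pdist p q <= pdist p q'}.
Proof.
  apply constructive_indefinite_description.
  destruct (segment_min_exists p a (psub b a)) as (t & Ht & Hmin).
  exists (seg_pt a (psub b a) t); split; [apply on_seg_seg_pt; eauto|].
  intros q' H'; apply on_seg_seg_pt in H'; destruct H' as (t' & Ht' & ->); auto.
Qed.

Definition foot (a b p : pt3) : pt3 := proj1_sig (foot_sig p a b).

Definition seg_dist (a b p : pt3) : R := pdist p (foot a b p).

Lemma foot_on_seg a b p : on_seg a b (foot a b p).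
Proof. apply (proj2_sig (foot_sig p a b)). Qed.

Lemma seg_dist_le a b p q : on_seg a b q -> seg_dist a b p <= pdist p q.
Proof. apply (proj2_sig (foot_sig p a b)). Qed.

Lemma seg_dist_ge0 a b p : 0 <= seg_dist a b p.
Proof. apply pdist_ge0. Qed.

Lemma seg_dist_eq0 a b p : seg_dist a b p = 0 <-> on_seg a b p.
Proof.
  split; intros H.
  - apply pdist_eq0 in H; rewrite H; apply foot_on_seg.
  - apply Rle_antisym; [|apply seg_dist_ge0].
    rewrite <- (pdist_self p); now apply seg_dist_le.
Qed.

Lemma seg_dist_lipschitz a b p q : seg_dist a b p <= seg_dist a b q + pdist p q.
Proof.
  eapply Rle_trans; [apply seg_dist_le, (foot_on_seg a b q)|].
  unfold seg_dist; rewrite Rplus_comm; apply pdist_triangle.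
Qed.

Lemma on_seg_convex a b x y t : 0 <= t <= 1 -> on_seg a b x -> on_seg a b y ->
  on_seg a b (padd (pscal (1 - t) x) (pscal t y)).
Proof.
  intros Ht (s1 & H1 & ->) (s2 & H2 & ->).
  exists ((1 - t) * s1 + t * s2); split; [nra|vec_eq].
Qed.

(** The combination of the two feet lies on the segment and competes with the true foot. This
    convexity is the source of the star shape of the slices. *)
Lemma seg_dist_convex a b p q t : 0 <= t <= 1 ->
  seg_dist a b (padd (pscal (1 - t) p) (pscal t q)) <=
  (1 - t) * seg_dist a b p + t * seg_dist a b q.
Proof.
  intros Ht; eapply Rle_trans; [|apply pdist_convex; auto].
  apply seg_dist_le, on_seg_convex; auto using foot_on_seg.
Qed.

(** * Convergent subsequences and limits in space *)

Lemma bounded_subsequence (u : nat -> R) (M : R) : (forall n, Rabs (u n) <= M) ->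
  exists (f : nat -> nat) (l : R),
    (forall n, (f n < f (S n))%nat) /\ is_lim_seq (fun n => u (f n)) l.
Proof.
  intros HM.
  destruct (Bolzano_Weierstrass u (fun x => - M <= x <= M)) as [l Hl].
  { apply compact_P3. }
  { intros n; apply Rabs_le_between, HM. }
  assert (Hs : forall N n, {p | (N <= p)%nat /\ Rabs (u p - l) < / (INR n + 1)}).
  { intros N n; apply constructive_indefinite_description.
    assert (Hn : 0 < / (INR n + 1)) by (apply Rinv_0_lt_compat; pose proof (pos_INR n); lra).
    destruct (Hl (disc l (mkposreal _ Hn)) N) as (p & Hp & Hd).
    { exists (mkposreal _ Hn); intros x Hx; exact Hx. }
    exists p; split; auto. }
  (* [Bolzano_Weierstrass] yields only a cluster value; each next index is picked beyond the
     previous one and within [/ (INR n + 1)] of that value. *)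
  set (f := nat_rect (fun _ => nat) (proj1_sig (Hs 0%nat 0%nat))
      (fun n k => proj1_sig (Hs (S k) (S n)))).
  exists f, l; split.
  - intros n; simpl; destruct (Hs (S (f n)) (S n)) as [p []]; simpl; lia.
  - assert (Hf : forall n, Rabs (u (f n) - l) < / (INR n + 1)).
    { intros [|n]; unfold f; cbn [nat_rect];
      match goal with |- Rabs (u (proj1_sig ?h) - l) < _ => apply (proj2 (proj2_sig h)) end. }
    apply is_lim_seq_spec; intros eps.
    destruct (archimed_cor1 eps (cond_pos eps)) as (N & HN & HN0).
    exists N; intros n Hn.
    eapply Rlt_trans; [apply Hf|]; eapply Rle_lt_trans; [|apply HN].
    apply Rinv_le_contravar; [apply lt_0_INR; lia|].
    apply le_INR in Hn; lra.
Qed.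

Lemma is_lim_seq_sub (u : nat -> R) (f : nat -> nat) (l : Rbar) :
  (forall n, (f n < f (S n))%nat) -> is_lim_seq u l -> is_lim_seq (fun n => u (f n)) l.
Proof.
  intros Hf Hu; apply (is_lim_seq_subseq u); auto.
  now apply eventually_subseq.
Qed.

Definition pX (p : pt3) : R := fst (fst p).
Definition pY (p : pt3) : R := snd (fst p).
Definition pZ (p : pt3) : R := snd p.

(** Convergence is coordinatewise, so that the limit rules for real sequences carry over to the
    vector operations; [lim_pt_pdist] recovers convergence in distance. *)
Definition lim_pt (u : nat -> pt3) (l : pt3) : Prop :=
  is_lim_seq (fun n => pX (u n)) (pX l) /\
  is_lim_seq (fun n => pY (u n)) (pY l) /\
  is_lim_seq (fun n => pZ (u n)) (pZ l).

Lemma coord_le_pnorm p :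
  Rabs (pX p) <= pnorm p /\ Rabs (pY p) <= pnorm p /\ Rabs (pZ p) <= pnorm p.
Proof.
  destruct p as [[x y] z]; unfold pX, pY, pZ, pnorm, pdot; simpl.
  repeat split; rewrite <- sqrt_Rsqr_abs; apply sqrt_le_1_alt; unfold Rsqr; nra.
Qed.

Lemma bounded_subsequence_pt (u : nat -> pt3) (M : R) : (forall n, pnorm (u n) <= M) ->
  exists (f : nat -> nat) (l : pt3),
    (forall n, (f n < f (S n))%nat) /\ lim_pt (fun n => u (f n)) l.
Proof.
  intros HM.
  assert (HM' : forall n, Rabs (pX (u n)) <= M /\ Rabs (pY (u n)) <= M /\ Rabs (pZ (u n)) <= M)
    by (intros n; pose proof (coord_le_pnorm (u n)); specialize (HM n); lra).
  destruct (bounded_subsequence (fun n => pX (u n)) M) as (f & x & Hf & Hx);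
    [intros; apply HM'|].
  destruct (bounded_subsequence (fun n => pY (u (f n))) M) as (g & y & Hg & Hy);
    [intros; apply HM'|].
  destruct (bounded_subsequence (fun n => pZ (u (f (g n)))) M) as (h & z & Hh & Hz);
    [intros; apply HM'|].
  assert (mono : forall f : nat -> nat, (forall n, (f n < f (S n))%nat) ->
            forall a b, (a < b)%nat -> (f a < f b)%nat).
  { intros k Hk a b Hab; induction Hab; [apply Hk|specialize (Hk m); lia]. }
  exists (fun n => f (g (h n))), (x, y, z); split; [|split; [|split]].
  - intros n; apply (mono f Hf), (mono g Hg), Hh.
  - apply (is_lim_seq_sub (fun n => pX (u (f n))) (fun n => g (h n)) x);
      [intros n; apply (mono g Hg), Hh|exact Hx].
  - apply (is_lim_seq_sub (fun n => pY (u (f (g n)))) h y); [exact Hh|exact Hy].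
  - exact Hz.
Qed.

Lemma lim_pt_const p : lim_pt (fun _ => p) p.
Proof. repeat split; apply is_lim_seq_const. Qed.

Lemma lim_pt_padd u v a b : lim_pt u a -> lim_pt v b ->
  lim_pt (fun n => padd (u n) (v n)) (padd a b).
Proof.
  assert (E : forall p q, pX (padd p q) = pX p + pX q /\ pY (padd p q) = pY p + pY q /\
     pZ (padd p q) = pZ p + pZ q) by (intros [[? ?] ?] [[? ?] ?]; auto).
  intros (? & ? & ?) (? & ? & ?); unfold lim_pt; destruct (E a b) as (-> & -> & ->).
  split; [|split]; (eapply is_lim_seq_ext; [intros n; symmetry; apply E|]);
    now apply is_lim_seq_plus'.
Qed.

Lemma lim_pt_pscal u v a b : is_lim_seq u (Finite a) -> lim_pt v b ->
  lim_pt (fun n => pscal (u n) (v n)) (pscal a b).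
Proof.
  assert (E : forall t p, pX (pscal t p) = t * pX p /\ pY (pscal t p) = t * pY p /\
     pZ (pscal t p) = t * pZ p) by (intros t [[? ?] ?]; auto).
  intros ? (? & ? & ?); unfold lim_pt; destruct (E a b) as (-> & -> & ->).
  split; [|split]; (eapply is_lim_seq_ext; [intros n; symmetry; apply E|]);
    now apply is_lim_seq_mult'.
Qed.

Lemma lim_pt_psub u v a b : lim_pt u a -> lim_pt v b ->
  lim_pt (fun n => psub (u n) (v n)) (psub a b).
Proof.
  intros; apply lim_pt_padd; auto; apply lim_pt_pscal; auto; apply is_lim_seq_const.
Qed.

Lemma lim_pt_pdot u v a b : lim_pt u a -> lim_pt v b ->
  is_lim_seq (fun n => pdot (u n) (v n)) (pdot a b).
Proof.
  assert (E : forall p q, pdot p q = pX p * pX q + pY p * pY q + pZ p * pZ q)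
    by (intros [[? ?] ?] [[? ?] ?]; auto).
  intros (? & ? & ?) (? & ? & ?); rewrite E.
  eapply is_lim_seq_ext; [intros n; symmetry; apply E|].
  repeat apply is_lim_seq_plus'; now apply is_lim_seq_mult'.
Qed.

Lemma lim_pt_pcross u v a b : lim_pt u a -> lim_pt v b ->
  lim_pt (fun n => pcross (u n) (v n)) (pcross a b).
Proof.
  assert (E : forall p q, pX (pcross p q) = pY p * pZ q - pZ p * pY q /\
     pY (pcross p q) = pZ p * pX q - pX p * pZ q /\
     pZ (pcross p q) = pX p * pY q - pY p * pX q) by (intros [[? ?] ?] [[? ?] ?]; auto).
  intros (? & ? & ?) (? & ? & ?); unfold lim_pt; destruct (E a b) as (-> & -> & ->).
  split; [|split]; (eapply is_lim_seq_ext; [intros n; symmetry; apply E|]);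
    apply is_lim_seq_minus'; now apply is_lim_seq_mult'.
Qed.

Lemma lim_pt_pdist u a : lim_pt u a -> is_lim_seq (fun n => pdist (u n) a) 0.
Proof.
  intros H; unfold pdist, pnorm.
  replace 0 with (sqrt (pdot (psub a a) (psub a a)))
    by (replace (pdot _ _) with 0 by vec_eq; apply sqrt_0).
  apply (is_lim_seq_continuous sqrt); [apply continuity_pt_sqrt, pdot_self_ge0|].
  assert (lim_pt (fun n => psub (u n) a) (psub a a)) by (apply lim_pt_psub; auto using lim_pt_const).
  now apply lim_pt_pdot.
Qed.

Lemma lim_le_const (u : nat -> R) (l c : R) :
  is_lim_seq u l -> (forall n, u n <= c) -> l <= c.
Proof.
  intros Hu H; exact (is_lim_seq_le u (fun _ => c) l c H Hu (is_lim_seq_const c)).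
Qed.

Lemma lim_ge_const (u : nat -> R) (l c : R) :
  is_lim_seq u l -> (forall n, c <= u n) -> c <= l.
Proof.
  intros Hu H; exact (is_lim_seq_le (fun _ => c) u c l H (is_lim_seq_const c) Hu).
Qed.

Lemma lim_unique (u v : nat -> R) (a b : R) :
  is_lim_seq u a -> is_lim_seq v b -> (forall n, u n = v n) -> a = b.
Proof.
  intros Hu Hv H; apply (is_lim_seq_ext _ _ _ H) in Hu.
  apply is_lim_seq_unique in Hu, Hv; congruence.
Qed.

(** A minimizing sequence has a convergent subsequence whose limit stays in [A]. The infimum is
    reached as minus the supremum of the values of [- F]. *)
Lemma compact_min_exists (A : pt3 -> Prop) (F : pt3 -> R) (M : R) :
  (exists p, A p) -> (forall p, A p -> pnorm p <= M) ->
  (forall u l, (forall n, A (u n)) -> lim_pt u l -> A l) ->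
  (forall u l, lim_pt u l -> is_lim_seq (fun n => F (u n)) (F l)) ->
  (forall p, 0 <= F p) ->
  exists p, A p /\ forall q, A q -> F p <= F q.
Proof.
  intros [p0 Hp0] HM Hcl HF H0.
  destruct (completeness (fun y => exists p, A p /\ y = - F p)) as [m [Hub Hlub]].
  { exists 0; intros y (p & _ & ->); specialize (H0 p); lra. }
  { exists (- F p0); eauto. }
  assert (Hs : forall n, {p | A p /\ F p <= - m + / (INR n + 1)}).
  { intros n; apply constructive_indefinite_description.
    assert (Hn : 0 < / (INR n + 1)) by (apply Rinv_0_lt_compat; pose proof (pos_INR n); lra).
    apply NNPP; intros Hno.
    assert (m <= m - / (INR n + 1)); [|lra].
    apply Hlub; intros y (p & Hp & ->); apply Rnot_lt_le; intros Hlt.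
    apply Hno; exists p; split; auto; lra. }
  destruct (bounded_subsequence_pt (fun n => proj1_sig (Hs n)) M) as (f & l & Hf & Hl).
  { intros n; destruct (Hs n) as [? []]; simpl; auto. }
  exists l; split.
  - apply (Hcl _ _ (fun n => proj1 (proj2_sig (Hs (f n)))) Hl).
  - intros q Hq; apply Rle_trans with (- m).
    + apply HF in Hl.
      assert (Hv : is_lim_seq (fun n => - m + / (INR (f n) + 1)) (- m)).
      { replace (Finite (- m)) with (Finite (- m + 0)) by (f_equal; ring).
        apply is_lim_seq_plus'; [apply is_lim_seq_const|].
        apply (is_lim_seq_sub (fun n => / (INR n + 1)) f); auto.
        apply (is_lim_seq_inv (fun n => INR n + 1) p_infty); [|discriminate].
        eapply is_lim_seq_plus; [apply is_lim_seq_INR|apply is_lim_seq_const|reflexivity]. }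
      refine (is_lim_seq_le _ _ (F l) (- m) _ Hl Hv).
      intros n; apply (proj2 (proj2_sig (Hs (f n)))).
    + assert (- F q <= m); [|lra]. apply Hub; eauto.
Qed.

(** * Edges and mitre normals *)

(** Congruent indices less than one period apart coincide; with [n] at least 3 this separates [i],
    [S i] and [S (S i)]. *)
Lemma mod_eq_close (n a b : nat) : (a mod n = b mod n)%nat -> (a <= b < a + n)%nat -> a = b.
Proof.
  intros H Hb.
  assert (Hn : n <> 0%nat) by lia.
  pose proof (Nat.div_mod a n Hn); pose proof (Nat.div_mod b n Hn).
  rewrite H in *; generalize dependent (a / n)%nat; generalize dependent (b / n)%nat.
  intros q' E' q E; assert (n * q' = n * q + (b - a))%nat by lia.
  assert (q = q' \/ q < q' \/ q' < q)%nat as [->|[]] by lia; [lia|nia|nia].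
Qed.

Lemma mod_S_eq (n a b : nat) : (a mod n = b mod n)%nat -> (S a mod n = S b mod n)%nat.
Proof.
  intros H; change (S a) with (1 + a)%nat; change (S b) with (1 + b)%nat.
  now rewrite (Nat.Div0.add_mod 1 a), (Nat.Div0.add_mod 1 b), H.
Qed.

Lemma mod_add_period (n a : nat) : ((a + n) mod n = a mod n)%nat.
Proof.
  replace (a + n)%nat with (a + 1 * n)%nat by lia; apply Nat.Div0.mod_add.
Qed.

Section Edges.
Context (K : polyknot).
Let n := pk_n K.

Definition edge_vec (i : nat) : pt3 := psub (vtx K (S i)) (vtx K i).
Definition edge_len (i : nat) : R := pnorm (edge_vec i).
Definition edge_dir (i : nat) : pt3 := pscal (/ edge_len i) (edge_vec i).

(** Normal vector of the mitre plane at [vtx K i], scaled to have dot product 1 with both edge directions;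
    its distance to each of them is the tangent of half the turning angle. *)
Definition mitre (i : nat) : pt3 :=
  pscal (/ (1 + pdot (edge_dir (prev_idx K i)) (edge_dir i)))
    (padd (edge_dir (prev_idx K i)) (edge_dir i)).

Definition edge_dist (i : nat) (p : pt3) : R := seg_dist (vtx K i) (vtx K (S i)) p.

(** Position relative to the two mitre planes of the edge, up to a positive factor a signed
    distance. The subtraction is reversed in [end_side], so that both are nonnegative between the
    planes. *)
Definition start_side (i : nat) (p : pt3) : R := pdot (psub p (vtx K i)) (mitre i).
Definition end_side (i : nat) (p : pt3) : R := pdot (psub (vtx K (S i)) p) (mitre (S i)).

Definition piece (i : nat) (r : R) (p : pt3) : Prop :=
  edge_dist i p <= r /\ 0 <= start_side i p /\ 0 <= end_side i p.

Context (HK : is_polyknot K).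

Lemma size_ge3 : (3 <= n)%nat. Proof. apply HK. Qed.

(** Indices are arbitrary naturals and every notion is periodic in them, so [S i] always denotes the
    next edge. [S (prev_idx K i)] is only congruent to [i], which is why each notion comes with such
    a transport lemma. *)
Lemma vtx_mod i j : (i mod n = j mod n)%nat -> vtx K i = vtx K j.
Proof. unfold vtx; fold n; intros ->; auto. Qed.

Lemma S_prev_mod i : (S (prev_idx K i) mod n = i mod n)%nat.
Proof.
  pose proof size_ge3; unfold prev_idx; fold n.
  replace (S (i + n - 1)) with (i + n)%nat by lia; apply mod_add_period.
Qed.

Lemma prev_S_mod i : (prev_idx K (S i) mod n = i mod n)%nat.
Proof.
  pose proof size_ge3; unfold prev_idx; fold n.
  replace (S i + n - 1)%nat with (i + n)%nat by lia; apply mod_add_period.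
Qed.

Lemma prev_mod i j : (i mod n = j mod n)%nat -> (prev_idx K i mod n = prev_idx K j mod n)%nat.
Proof.
  intros H; pose proof size_ge3; unfold prev_idx; fold n.
  replace (i + n - 1)%nat with (i + (n - 1))%nat by lia.
  replace (j + n - 1)%nat with (j + (n - 1))%nat by lia.
  now rewrite (Nat.Div0.add_mod i), (Nat.Div0.add_mod j), H.
Qed.

Lemma edge_vec_mod i j : (i mod n = j mod n)%nat -> edge_vec i = edge_vec j.
Proof.
  intros H; unfold edge_vec; rewrite (vtx_mod i j H), (vtx_mod (S i) (S j)); auto.
  now apply mod_S_eq.
Qed.

Lemma edge_dir_mod i j : (i mod n = j mod n)%nat -> edge_dir i = edge_dir j.
Proof. intros H; unfold edge_dir, edge_len; now rewrite (edge_vec_mod i j H). Qed.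

Lemma mitre_mod i j : (i mod n = j mod n)%nat -> mitre i = mitre j.
Proof.
  intros H; unfold mitre; rewrite (edge_dir_mod i j H).
  now rewrite (edge_dir_mod _ _ (prev_mod i j H)).
Qed.

Lemma mitre_S i : mitre (S i) =
  pscal (/ (1 + pdot (edge_dir i) (edge_dir (S i)))) (padd (edge_dir i) (edge_dir (S i))).
Proof. unfold mitre; now rewrite (edge_dir_mod _ _ (prev_S_mod i)). Qed.

Lemma edge_dist_mod i j p : (i mod n = j mod n)%nat -> edge_dist i p = edge_dist j p.
Proof.
  intros H; unfold edge_dist; rewrite (vtx_mod i j H), (vtx_mod (S i) (S j)); auto.
  now apply mod_S_eq.
Qed.

Lemma piece_mod i j r p : (i mod n = j mod n)%nat -> piece i r p -> piece j r p.
Proof.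
  intros H; pose proof (mod_S_eq _ _ _ H) as H'.
  unfold piece, start_side, end_side.
  rewrite (edge_dist_mod i j p H), (vtx_mod i j H), (vtx_mod _ _ H'),
    (mitre_mod i j H), (mitre_mod _ _ H'); auto.
Qed.

Lemma edge_vec_neq0 i : edge_vec i <> (0, 0, 0).
Proof.
  pose proof size_ge3 as Hn; intros H; apply psub_eq0 in H.
  destruct HK as (_ & Hd & _).
  rewrite (vtx_mod i (i mod n)), (vtx_mod (S i) (S i mod n)) in H
    by (symmetry; apply Nat.Div0.mod_mod).
  refine (Hd _ _ _ _ _ H); fold n; [apply Nat.mod_upper_bound; lia..|].
  intros E; symmetry in E; apply mod_eq_close in E; lia.
Qed.

Lemma edge_len_gt0 i : 0 < edge_len i.
Proof. apply pnorm_gt0, edge_vec_neq0. Qed.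

Lemma edge_dir_unit i : pdot (edge_dir i) (edge_dir i) = 1.
Proof.
  unfold edge_dir; expand_dot; rewrite <- pnorm_sqr; fold (edge_len i).
  pose proof (edge_len_gt0 i); field; lra.
Qed.

Lemma edge_vec_dir i : edge_vec i = pscal (edge_len i) (edge_dir i).
Proof.
  unfold edge_dir; pose proof (edge_len_gt0 i) as H; set (l := edge_len i) in *.
  generalize (edge_vec i); intros e; coords; split_pairs; field; lra.
Qed.

Lemma on_edge_seg_pt i p :
  on_edge K i p <-> exists t, 0 <= t <= 1 /\ p = seg_pt (vtx K i) (edge_vec i) t.
Proof. apply on_seg_seg_pt. Qed.

Lemma edges_meet i j p : (i mod n <> j mod n)%nat -> on_edge K i p -> on_edge K j p ->
  (j mod n = S i mod n)%nat /\ p = vtx K (S i) \/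
  (i mod n = S j mod n)%nat /\ p = vtx K (S j).
Proof.
  intros Hne Hi Hj; pose proof size_ge3 as Hn.
  assert (Hm : forall a, on_edge K a p -> on_edge K (a mod n) p).
  { intros a; unfold on_edge.
    rewrite (vtx_mod (a mod n) a), (vtx_mod (S (a mod n)) (S a)); auto;
      [apply mod_S_eq|]; apply Nat.Div0.mod_mod. }
  destruct HK as (_ & _ & Hk).
  assert (Hb : forall a, (a mod n < n)%nat) by (intros; apply Nat.mod_upper_bound; lia).
  destruct (Hk (i mod n)%nat (j mod n)%nat p (Hb _) (Hb _) Hne (Hm _ Hi) (Hm _ Hj)) as [[H1 H2]|[H1 H2]];
    fold n in H1; [left|right]; (split;
      [rewrite H1; apply mod_S_eq, Nat.Div0.mod_mod
      |rewrite H2; apply vtx_mod, mod_S_eq, Nat.Div0.mod_mod]).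
Qed.

(** Opposite directions would make the next edge run back over the present one, and the two edges
    would share a point other than their common vertex. *)
Lemma turn_dot_gt i : -1 < pdot (edge_dir i) (edge_dir (S i)).
Proof.
  set (c := pdot _ _).
  pose proof (edge_dir_unit i) as Hu; pose proof (edge_dir_unit (S i)) as Hu'.
  pose proof (pdot_self_ge0 (padd (edge_dir i) (edge_dir (S i)))) as Hs.
  revert Hs; expand_dot; rewrite (pdot_comm (edge_dir (S i)) (edge_dir i)); fold c.
  intros Hs; apply Rnot_le_lt; intros Hc.
  assert (E : padd (edge_dir i) (edge_dir (S i)) = (0, 0, 0)).
  { apply pdot_self_eq0; expand_dot; rewrite (pdot_comm (edge_dir (S i)) (edge_dir i)).
    fold c; lra. }
  pose proof (edge_len_gt0 i) as Hl; pose proof (edge_len_gt0 (S i)) as Hl'.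
  (* Chosen so that [t * l' = (1 - t) * l]: the point at fraction [t] of the next edge is then also
     at fraction [t] of the present one. *)
  set (t := edge_len i / (edge_len i + edge_len (S i))).
  set (l := edge_len i) in *; set (l' := edge_len (S i)) in *.
  assert (Ht : 0 < t < 1).
  { unfold t; split; [apply Rdiv_lt_0_compat; lra|].
    apply Rmult_lt_reg_r with (l + l'); [lra|].
    unfold Rdiv; rewrite Rmult_assoc, Rinv_l; lra. }
  assert (Htl : t * l' = (1 - t) * l) by (unfold t; field; lra).
  set (p := seg_pt (vtx K (S i)) (edge_vec (S i)) t).
  assert (Hp : p <> vtx K (S i)).
  { intros Ep; apply (edge_vec_neq0 (S i)).
    unfold p, seg_pt in Ep; generalize dependent (edge_vec (S i)).
    generalize (vtx K (S i)); clear - Ht; intros; coords.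
    injection Ep as E1 E2 E3; split_pairs; nra. }
  assert (Hv : vtx K (S i) = seg_pt (vtx K i) (edge_vec i) 1)
    by (unfold seg_pt, edge_vec; vec_eq).
  assert (H1 : on_edge K (S i) p) by (apply on_edge_seg_pt; exists t; split; [lra|auto]).
  assert (H2 : on_edge K i p).
  { apply on_edge_seg_pt; exists t; split; [lra|]; unfold p; rewrite Hv.
    rewrite !edge_vec_dir; fold l l'; clear p Hp H1 Hv.
    revert E; generalize (edge_dir (S i)), (edge_dir i), (vtx K i).
    clear - Htl; intros d v d'; intros; revert E; unfold seg_pt; coords; intros E.
    injection E as E1 E2 E3.
    rewrite <- !Rmult_assoc, Htl; split_pairs; nra. }
  pose proof size_ge3 as Hn.
  destruct (edges_meet i (S i) p) as [[_ ?]|[E' _]]; auto.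
  - intros E'; apply mod_eq_close in E'; lia.
  - apply mod_eq_close in E'; lia.
Qed.

End Edges.

(** * Mitre normals and the minimal radius *)

Lemma Rbar_lt_min x a b : Rbar_lt x (Rbar_min a b) -> Rbar_lt x a /\ Rbar_lt x b.
Proof.
  intros H; split; eapply Rbar_lt_le_trans; eauto; [apply Rbar_min_l|apply Rbar_min_r].
Qed.

Lemma Rbar_lt_fold_min x (f : nat -> Rbar) l :
  Rbar_lt x (fold_right Rbar_min p_infty (map f l)) -> forall i, In i l -> Rbar_lt x (f i).
Proof.
  induction l as [|a l IH]; simpl; [tauto|].
  intros H i [<-|Hi]; apply Rbar_lt_min in H; [tauto|apply IH; tauto].
Qed.

Lemma tan_half_acos c : -1 < c < 1 ->
  0 < tan (acos c / 2) /\ tan (acos c / 2) * tan (acos c / 2) = (1 - c) / (1 + c).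
Proof.
  intros Hc; pose proof (acos_bound_lt c Hc) as Hb; pose proof (cos_acos c ltac:(lra)) as Hcos.
  set (h := acos c / 2) in *.
  replace (acos c) with (2 * h) in * by (unfold h; field).
  assert (0 < cos h) by (apply cos_gt_0; lra).
  assert (0 < sin h) by (apply sin_gt_0; lra).
  rewrite cos_2a_cos in Hcos; pose proof (sin2_cos2 h) as Hsc; unfold Rsqr in Hsc.
  unfold tan; split; [apply Rdiv_lt_0_compat; auto|].
  replace (1 - c) with (2 * (sin h * sin h)) by lra.
  replace (1 + c) with (2 * (cos h * cos h)) by lra.
  field; lra.
Qed.

Section Mitre.
Context (K : polyknot) (HK : is_polyknot K).
Let n := pk_n K.

Lemma mitre_dot_prev_dir i : pdot (mitre K (S i)) (edge_dir K i) = 1.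
Proof.
  rewrite mitre_S by auto; expand_dot; rewrite edge_dir_unit by auto.
  rewrite (pdot_comm (edge_dir K (S i))); pose proof (turn_dot_gt K HK i); field; lra.
Qed.

Lemma mitre_dot_dir i : pdot (mitre K i) (edge_dir K i) = 1.
Proof.
  rewrite <- (mitre_mod K HK _ _ (S_prev_mod K HK i)).
  rewrite <- (edge_dir_mod K _ _ (S_prev_mod K HK i)).
  generalize (prev_idx K i); clear i; intros i.
  rewrite mitre_S by auto; expand_dot; rewrite edge_dir_unit by auto.
  pose proof (turn_dot_gt K HK i); field; lra.
Qed.

Lemma mitre_sqr i : pdot (mitre K (S i)) (mitre K (S i)) =
  2 / (1 + pdot (edge_dir K i) (edge_dir K (S i))).
Proof.
  rewrite mitre_S by auto; expand_dot; rewrite !edge_dir_unit by auto.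
  rewrite (pdot_comm (edge_dir K (S i)) (edge_dir K i)).
  pose proof (turn_dot_gt K HK i); field; lra.
Qed.

(** With c the cosine of the turning angle, the right-hand side is the squared tangent of half that
    angle; it follows from |m|^2 = 2/(1+c) and m.d = 1. This ties the mitre normal to the
    denominator of [Rad]. *)
Lemma mitre_sub_dir_sqr i d : d = edge_dir K i \/ d = edge_dir K (S i) ->
  pdot (psub (mitre K (S i)) d) (psub (mitre K (S i)) d) =
  (1 - pdot (edge_dir K i) (edge_dir K (S i))) / (1 + pdot (edge_dir K i) (edge_dir K (S i))).
Proof.
  pose proof (turn_dot_gt K HK i) as Hc.
  intros Hd; expand_dot; rewrite mitre_sqr, (pdot_comm d).
  replace (pdot (mitre K (S i)) d) with 1
    by (destruct Hd as [->| ->]; symmetry; [apply mitre_dot_prev_dir|apply mitre_dot_dir]).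
  replace (pdot d d) with 1
    by (destruct Hd as [->| ->]; symmetry; now apply edge_dir_unit).
  field; lra.
Qed.

Lemma turn_dot_le1 i : pdot (edge_dir K i) (edge_dir K (S i)) <= 1.
Proof.
  pose proof (pdot_self_ge0 (psub (edge_dir K i) (edge_dir K (S i)))) as H; revert H.
  expand_dot; rewrite !edge_dir_unit, (pdot_comm (edge_dir K (S i)) (edge_dir K i)) by auto.
  lra.
Qed.

Lemma angle_at_S i : angle_at K (S i) = acos (pdot (edge_dir K i) (edge_dir K (S i))).
Proof.
  unfold angle_at; rewrite (vtx_mod K _ _ (prev_S_mod K HK i)).
  fold (edge_vec K i) (edge_vec K (S i)) (edge_len K i) (edge_len K (S i)).
  f_equal; unfold edge_dir; expand_dot.
  pose proof (edge_len_gt0 K HK i); pose proof (edge_len_gt0 K HK (S i)); field; lra.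
Qed.

Lemma Rad_mod i j : (i mod n = j mod n)%nat -> Rad K i = Rad K j.
Proof.
  intros H; unfold Rad, angle_at.
  rewrite (vtx_mod K _ _ H), (vtx_mod K _ _ (mod_S_eq _ _ _ H)),
    (vtx_mod K _ _ (prev_mod K HK _ _ H)); auto.
Qed.

Lemma lt_MinRad_Rad r i : Rbar_lt r (MinRad K) -> Rbar_lt r (Rad K i).
Proof.
  intros H; pose proof (size_ge3 K HK).
  rewrite (Rad_mod i (i mod n)) by (symmetry; apply Nat.Div0.mod_mod).
  apply (Rbar_lt_fold_min r (Rad K) _ H), in_seq; simpl.
  split; [lia|]; apply Nat.mod_upper_bound; unfold n; lia.
Qed.

(** [r < Rad] multiplied out: r tan(angle/2) is less than half of either adjacent edge length, and
    the tangent is the norm of [mitre - d]. *)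
Lemma mitre_bound (r : R) i d : Rbar_lt r (MinRad K) -> d = edge_dir K i \/ d = edge_dir K (S i) ->
  r * pnorm (psub (mitre K (S i)) d) < edge_len K i / 2 /\
  r * pnorm (psub (mitre K (S i)) d) < edge_len K (S i) / 2.
Proof.
  intros Hr Hd; apply (lt_MinRad_Rad r (S i)) in Hr.
  pose proof (mitre_sub_dir_sqr i d Hd) as Hs; rewrite <- pnorm_sqr in Hs.
  pose proof (pnorm_ge0 (psub (mitre K (S i)) d)) as H0.
  pose proof (turn_dot_gt K HK i); pose proof (turn_dot_le1 i).
  pose proof (edge_len_gt0 K HK i); pose proof (edge_len_gt0 K HK (S i)).
  unfold Rad in Hr; rewrite angle_at_S, (vtx_mod K _ _ (prev_S_mod K HK i)) in Hr.
  rewrite (pdist_sym (vtx K i)), (pdist_sym (vtx K (S i)) (vtx K (S (S i)))) in Hr.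
  unfold pdist in Hr.
  fold (edge_vec K i) (edge_vec K (S i)) (edge_len K i) (edge_len K (S i)) in Hr.
  set (c := pdot (edge_dir K i) (edge_dir K (S i))) in *.
  set (x := pnorm (psub (mitre K (S i)) d)) in *.
  destruct (Req_EM_T (acos c) 0) as [E|E].
  (* Without a turn [Rad] is infinite, but then the mitre normal is the edge direction and the
     left-hand side is 0. *)
  - assert (Ec : c = 1) by (rewrite <- (cos_acos c), E by lra; apply cos_0).
    rewrite Ec in Hs; replace ((1 - 1) / (1 + 1)) with 0 in Hs by field.
    assert (x = 0) as -> by nra; lra.
  - assert (c <> 1) by (intros ->; apply E, acos_1).
    destruct (tan_half_acos c) as [Ht Ht2]; [lra|].
    set (t := tan (acos c / 2)) in *.
    assert (x = t) as -> by nra.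
    simpl in Hr.
    assert (r * t < Rmin (edge_len K i) (edge_len K (S i)) / 2).
    { apply Rmult_lt_compat_r with (r := t) in Hr; auto.
      eapply Rlt_le_trans; [apply Hr|]; right; field; lra. }
    pose proof (Rmin_l (edge_len K i) (edge_len K (S i))).
    pose proof (Rmin_r (edge_len K i) (edge_len K (S i))); lra.
Qed.

End Mitre.

(** * The tube around an edge *)

Lemma seg_pt_0 v e : seg_pt v e 0 = v.
Proof. unfold seg_pt; vec_eq. Qed.

(* Reflection in the plane through [v] orthogonal to [a - b] exchanges the directions [a] and [b]. *)
Lemma reflect_nearer (v a b m p : pt3) (la lb k r t : R) :
  pdot a a = 1 -> pdot b b = 1 -> 0 < k -> m = pscal k (psub a b) -> pdot m a = 1 ->
  r * pnorm (psub m a) < lb ->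
  0 <= t <= la -> (forall s, 0 <= s <= la -> pdist p (seg_pt v a t) <= pdist p (seg_pt v a s)) ->
  pdist p (seg_pt v a t) <= r -> pdot (psub p v) m <= 0 ->
  t <= lb /\ pdist p (seg_pt v b t) <= pdist p (seg_pt v a t) /\
  (pdot (psub p v) m < 0 -> 0 < t -> pdist p (seg_pt v b t) < pdist p (seg_pt v a t)).
Proof.
  intros Ha Hb Hk Hm Hma Hr Ht Hmin Hd Hp.
  (* Replacing the point on [a] by its mirror image on [b] changes the squared distance by a term
     with the sign of (p-v).m. *)
  assert (E : pdot (psub p (seg_pt v b t)) (psub p (seg_pt v b t)) =
    pdot (psub p (seg_pt v a t)) (psub p (seg_pt v a t))
    + 2 * t * pdot (psub p v) (psub a b) + t * t * (pdot b b - pdot a a))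
    by (unfold seg_pt; vec_eq).
  rewrite Ha, Hb in E.
  assert (Hpm : pdot (psub p v) m = k * pdot (psub p v) (psub a b))
    by (rewrite Hm; apply pdot_pscal_r).
  rewrite Hpm in *; set (c := pdot (psub p v) (psub a b)) in *.
  assert (c <= 0) by (apply Rnot_lt_le; intros Hc; pose proof (Rmult_lt_0_compat _ _ Hk Hc); lra).
  split; [|split].
  - pose proof (pnorm_ge0 (psub m a)) as Hn.
    destruct (proj1 Ht) as [Ht0|Ht0].
    + assert (Hz : pdot (psub p (seg_pt v a t)) (pscal (-1) a) <= 0).
      { apply (nearest_pdot_le _ _ _ t); auto; intros s Hs.
        replace (seg_pt (seg_pt v a t) (pscal (-1) a) s) with (seg_pt v a (t - s))
          by (unfold seg_pt; vec_eq).
        apply Hmin; lra. }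
      (* With x the nearest point, (p-v).m = t + (p-x).(m-a) + (p-x).a. The last term is nonnegative
         because sliding back along [a] gains nothing, so t is at most r|m-a| < [lb]: the mirror
         image still lies on the other edge. *)
      assert (E2 : pdot (psub p v) m = t * pdot m a + pdot (psub p (seg_pt v a t)) (psub m a)
         - pdot (psub p (seg_pt v a t)) (pscal (-1) a)) by (unfold seg_pt; vec_eq).
      pose proof (pdot_ge (psub p (seg_pt v a t)) (psub m a)) as Hcs.
      unfold pdist in Hd.
      assert (pnorm (psub p (seg_pt v a t)) * pnorm (psub m a) <= r * pnorm (psub m a))
        by (apply Rmult_le_compat_r; auto).
      rewrite Hpm, Hma in E2; lra.
    + pose proof (pdist_ge0 p (seg_pt v a t)).
      assert (0 <= r * pnorm (psub m a)) by (apply Rmult_le_pos; lra); lra.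
  - apply pdist_le_of_sqr; nra.
  - intros Hc Ht0; apply pdist_lt_of_sqr; rewrite E.
    assert (c < 0) by (apply Rnot_le_lt; intros Hc'; pose proof (Rmult_le_pos _ _ (Rlt_le _ _ Hk) Hc'); lra).
    nra.
Qed.

Lemma dot_pos_near c m p : 0 < c + pdot p m ->
  exists eps, 0 < eps /\ forall p', pdist p' p < eps -> 0 < c + pdot p' m.
Proof.
  intros H; pose proof (pnorm_ge0 m).
  exists ((c + pdot p m) / (pnorm m + 1)); split; [apply Rdiv_lt_0_compat; lra|].
  intros p' Hp'; rewrite pdist_sym in Hp'.
  pose proof (pdot_sub_le p p' m); pose proof (pdist_ge0 p p').
  apply Rmult_lt_compat_r with (r := pnorm m + 1) in Hp'; [|lra].
  unfold Rdiv in Hp'; rewrite Rmult_assoc, Rinv_l in Hp'; lra.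
Qed.

Lemma finite_argmin (f : nat -> R) (n : nat) : (0 < n)%nat ->
  exists i, (i < n)%nat /\ forall j, (j < n)%nat -> f i <= f j.
Proof.
  induction n as [|[|n] IH]; intros Hn; [lia| |].
  - exists 0%nat; split; [lia|]; intros j Hj; replace j with 0%nat by lia; lra.
  - destruct IH as (i & Hi & Hmin); [lia|].
    destruct (Rle_dec (f i) (f (S n))) as [H|H%Rnot_le_lt].
    + exists i; split; [lia|]; intros j Hj; inversion Hj; subst; auto.
    + exists (S n); split; [lia|]; intros j Hj; inversion Hj; subst; [lra|].
      specialize (Hmin j); lra || (assert (f i <= f j) by auto; lra).
Qed.

Section LocalTube.
Context (K : polyknot) (HK : is_polyknot K) (r : R) (Hr : Rbar_lt r (MinRad K)).
Let n := pk_n K.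

Lemma vtx_S i : vtx K (S i) = seg_pt (vtx K i) (edge_dir K i) (edge_len K i).
Proof.
  unfold seg_pt; rewrite <- edge_vec_dir by auto; unfold edge_vec; vec_eq.
Qed.

Lemma on_edge_from_start i p :
  on_edge K i p <-> exists t, 0 <= t <= edge_len K i /\ p = seg_pt (vtx K i) (edge_dir K i) t.
Proof.
  pose proof (edge_len_gt0 K HK i) as Hl.
  rewrite on_edge_seg_pt; rewrite edge_vec_dir by auto.
  generalize (vtx K i), (edge_dir K i); intros v e; split; intros (t & Ht & ->).
  - exists (t * edge_len K i); split; [nra|unfold seg_pt; vec_eq].
  - exists (t / edge_len K i); split.
    + split; [apply Rdiv_le_0_compat; lra|apply Rle_div_l; lra].
    + unfold seg_pt; coords; split_pairs; field; lra.
Qed.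

Lemma on_edge_from_end i p :
  on_edge K i p <->
  exists t, 0 <= t <= edge_len K i /\ p = seg_pt (vtx K (S i)) (pscal (-1) (edge_dir K i)) t.
Proof.
  rewrite on_edge_from_start, vtx_S.
  generalize (vtx K i), (edge_dir K i), (edge_len K i); intros v e l.
  split; intros (t & Ht & ->); exists (l - t); (split; [lra|unfold seg_pt; vec_eq]).
Qed.

Lemma mitre_bound_start i : r * pnorm (psub (mitre K i) (edge_dir K i)) < edge_len K i / 2.
Proof.
  pose proof (S_prev_mod K HK i) as E.
  pose proof (mitre_bound K HK r (prev_idx K i) _ Hr (or_intror eq_refl)) as [_ H].
  unfold edge_len in *; now rewrite (mitre_mod K HK _ _ E), (edge_dir_mod K _ _ E), (edge_vec_mod K _ _ E) in H.
Qed.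

Lemma mitre_bound_end i : r * pnorm (psub (mitre K (S i)) (edge_dir K i)) < edge_len K i / 2.
Proof. apply (mitre_bound K HK r i _ Hr (or_introl eq_refl)). Qed.

(** By Cauchy-Schwarz, replacing the edge direction by either mitre normal changes the product with
    [z] by at most r|m-d|, which is less than half the edge. *)
Lemma dot_mitre_lower i z : pnorm z <= r ->
  pdot z (edge_dir K i) - edge_len K i / 2 < pdot z (mitre K i) < pdot z (edge_dir K i) + edge_len K i / 2 /\
  pdot z (edge_dir K i) - edge_len K i / 2 < pdot z (mitre K (S i)) < pdot z (edge_dir K i) + edge_len K i / 2.
Proof.
  intros Hz; pose proof (mitre_bound_start i); pose proof (mitre_bound_end i).
  assert (Hb : forall m, r * pnorm (psub m (edge_dir K i)) < edge_len K i / 2 ->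
    pdot z (edge_dir K i) - edge_len K i / 2 < pdot z m < pdot z (edge_dir K i) + edge_len K i / 2);
    [|auto].
  intros m Hm; pose proof (pdot_ge z (psub m (edge_dir K i))) as H1.
  pose proof (pdot_le z (psub m (edge_dir K i))) as H2.
  pose proof (pnorm_ge0 (psub m (edge_dir K i))).
  assert (pnorm z * pnorm (psub m (edge_dir K i)) <= r * pnorm (psub m (edge_dir K i)))
    by (apply Rmult_le_compat_r; auto).
  rewrite pdot_psub_r in H1, H2; lra.
Qed.

Lemma end_side_start_side i p : end_side K i p = - start_side K (S i) p.
Proof. unfold end_side, start_side; generalize (mitre K (S i)); vec_eq. Qed.

(** The foot contributes t to one side and l-t to the other; the offset from the foot changes their
    sum l by less than l/2 for each mitre plane. This is the form in which the two planes do not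
    meet inside the tube. *)
Lemma sides_sum_gt0 i p : edge_dist K i p <= r -> 0 < start_side K i p + end_side K i p.
Proof.
  intros H; unfold edge_dist, seg_dist in H.
  pose proof (foot_on_seg (vtx K i) (vtx K (S i)) p) as Hx.
  set (x := foot _ _ _) in *; apply on_edge_from_start in Hx; destruct Hx as (t & Ht & Hx).
  destruct (dot_mitre_lower i (psub p x) H) as [H1 H2].
  pose proof (mitre_dot_dir K HK i) as E1; pose proof (mitre_dot_prev_dir K HK i) as E2.
  unfold start_side, end_side.
  replace (pdot (psub p (vtx K i)) (mitre K i))
    with (t * pdot (mitre K i) (edge_dir K i) + pdot (psub p x) (mitre K i)).
  2:{ rewrite Hx; generalize (mitre K i), (edge_dir K i); unfold seg_pt; vec_eq. }
  replace (pdot (psub (vtx K (S i)) p) (mitre K (S i)))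
    with ((edge_len K i - t) * pdot (mitre K (S i)) (edge_dir K i) - pdot (psub p x) (mitre K (S i))).
  2:{ rewrite Hx, vtx_S; generalize (mitre K (S i)), (edge_dir K i), (edge_len K i); unfold seg_pt; vec_eq. }
  rewrite E1, E2; lra.
Qed.

Definition edge_foot i p := foot (vtx K i) (vtx K (S i)) p.

Lemma edge_foot_on i p : on_edge K i (edge_foot i p).
Proof. apply foot_on_seg. Qed.

Lemma edge_dist_foot i p : edge_dist K i p = pdist p (edge_foot i p).
Proof. reflexivity. Qed.

Lemma edge_dist_le i p q : on_edge K i q -> edge_dist K i p <= pdist p q.
Proof. apply seg_dist_le. Qed.

Lemma mitre_S_scal i : exists k, 0 < k /\
  mitre K (S i) = pscal k (padd (edge_dir K i) (edge_dir K (S i))).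
Proof.
  pose proof (turn_dot_gt K HK i).
  exists (/ (1 + pdot (edge_dir K i) (edge_dir K (S i)))); split; [|now apply mitre_S].
  apply Rinv_0_lt_compat; lra.
Qed.

(** Beyond the end mitre plane, reflecting the foot gives a point of the next edge that is no
    farther. Strictly beyond it the gain is strict, unless the foot is the common vertex, which the
    reflection fixes. *)
Lemma edge_dist_next i p : edge_dist K i p <= r -> end_side K i p <= 0 ->
  edge_dist K (S i) p <= edge_dist K i p /\
  (end_side K i p < 0 -> edge_dist K i p <= edge_dist K (S i) p -> edge_foot i p = vtx K (S i)).
Proof.
  intros Hd Hs; destruct (mitre_S_scal i) as (k & Hk & Hm).
  pose proof (edge_foot_on i p) as Hx; apply on_edge_from_end in Hx; destruct Hx as (t & Ht & Hx).
  pose proof (mitre_dot_prev_dir K HK i) as Hmd.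
  pose proof (edge_dir_unit K HK i) as Hu; pose proof (edge_dir_unit K HK (S i)) as Hu'.
  destruct (mitre_bound K HK r i _ Hr (or_introl eq_refl)) as [_ Hb].
  pose proof (edge_len_gt0 K HK (S i)) as Hl.
  assert (Hside : end_side K i p = pdot (psub p (vtx K (S i))) (pscal (-1) (mitre K (S i))))
    by (unfold end_side; generalize (mitre K (S i)); vec_eq).
  (* Seen from the common vertex the edge runs backwards, so its direction and the mitre normal
     change sign. *)
  destruct (reflect_nearer (vtx K (S i)) (pscal (-1) (edge_dir K i)) (edge_dir K (S i))
    (pscal (-1) (mitre K (S i))) p (edge_len K i) (edge_len K (S i)) k r t) as (H1 & H2 & H3); auto.
  - rewrite <- Hu; generalize (edge_dir K i); vec_eq.
  - rewrite Hm; generalize (edge_dir K i), (edge_dir K (S i)); vec_eq.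
  - rewrite <- Hmd; generalize (edge_dir K i), (mitre K (S i)); vec_eq.
  - replace (psub _ _) with (pscal (-1) (psub (mitre K (S i)) (edge_dir K i)))
      by (generalize (edge_dir K i), (mitre K (S i)); vec_eq).
    rewrite pnorm_pscal, Rabs_left by lra; lra.
  - intros s Hs'; rewrite <- Hx, <- edge_dist_foot; apply edge_dist_le.
    apply on_edge_from_end; eauto.
  - rewrite <- Hx, <- edge_dist_foot; auto.
  - rewrite <- Hside; auto.
  - rewrite <- Hx, <- edge_dist_foot, <- Hside in *.
    assert (Hq : on_edge K (S i) (seg_pt (vtx K (S i)) (edge_dir K (S i)) t))
      by (apply on_edge_from_start; exists t; split; [lra|auto]).
    apply (edge_dist_le _ p) in Hq; split; [lra|]; intros Hneg He.
    destruct (proj1 Ht) as [Ht0|Ht0]; [specialize (H3 Hneg Ht0); lra|].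
    rewrite Hx, <- Ht0; apply seg_pt_0.
Qed.

Lemma edge_dist_prev i p : edge_dist K (S i) p <= r -> start_side K (S i) p <= 0 ->
  edge_dist K i p <= edge_dist K (S i) p /\
  (start_side K (S i) p < 0 -> edge_dist K (S i) p <= edge_dist K i p ->
   edge_foot (S i) p = vtx K (S i)).
Proof.
  intros Hd Hs; destruct (mitre_S_scal i) as (k & Hk & Hm).
  pose proof (edge_foot_on (S i) p) as Hx; apply on_edge_from_start in Hx; destruct Hx as (t & Ht & Hx).
  pose proof (edge_dir_unit K HK i) as Hu; pose proof (edge_dir_unit K HK (S i)) as Hu'.
  destruct (mitre_bound K HK r i _ Hr (or_intror eq_refl)) as [Hb _].
  pose proof (edge_len_gt0 K HK i) as Hl.
  destruct (reflect_nearer (vtx K (S i)) (edge_dir K (S i)) (pscal (-1) (edge_dir K i))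
    (mitre K (S i)) p (edge_len K (S i)) (edge_len K i) k r t) as (H1 & H2 & H3); auto.
  - rewrite <- Hu; generalize (edge_dir K i); vec_eq.
  - rewrite Hm; generalize (edge_dir K i), (edge_dir K (S i)); vec_eq.
  - now apply mitre_dot_dir.
  - lra.
  - intros s Hs'; rewrite <- Hx, <- edge_dist_foot; apply edge_dist_le.
    apply on_edge_from_start; eauto.
  - rewrite <- Hx, <- edge_dist_foot; auto.
  - fold (start_side K (S i) p) in H3; rewrite <- Hx, <- edge_dist_foot in *.
    assert (Hq : on_edge K i (seg_pt (vtx K (S i)) (pscal (-1) (edge_dir K i)) t))
      by (apply on_edge_from_end; exists t; split; [lra|auto]).
    apply (edge_dist_le _ p) in Hq; split; [lra|]; intros Hneg He.
    destruct (proj1 Ht) as [Ht0|Ht0]; [specialize (H3 Hneg Ht0); lra|].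
    rewrite Hx, <- Ht0; apply seg_pt_0.
Qed.

Lemma nearest_end_dot i p : (forall q, on_edge K i q -> pdist p (vtx K (S i)) <= pdist p q) ->
  0 <= pdot (psub p (vtx K (S i))) (edge_dir K i).
Proof.
  intros H; assert (pdot (psub p (vtx K (S i))) (pscal (-1) (edge_dir K i)) <= 0).
  { apply (nearest_pdot_le _ _ _ (edge_len K i)); [now apply edge_len_gt0|].
    intros t Ht; apply H, on_edge_from_end; eauto. }
  rewrite pdot_pscal_r in *; lra.
Qed.

Lemma nearest_start_dot i p : (forall q, on_edge K i q -> pdist p (vtx K i) <= pdist p q) ->
  pdot (psub p (vtx K i)) (edge_dir K i) <= 0.
Proof.
  intros H; apply (nearest_pdot_le _ _ _ (edge_len K i)); [now apply edge_len_gt0|].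
  intros t Ht; apply H, on_edge_from_start; eauto.
Qed.

(** Relative to the end vertex the start side is the full edge length plus a product that exceeds
    minus half of it. *)
Lemma near_end_start_side i p : pdist p (vtx K (S i)) <= r ->
  0 <= pdot (psub p (vtx K (S i))) (edge_dir K i) -> 0 < start_side K i p.
Proof.
  intros Hd H; destruct (dot_mitre_lower i _ Hd) as [H1 _].
  pose proof (edge_len_gt0 K HK i); pose proof (mitre_dot_dir K HK i) as E.
  replace (start_side K i p) with (edge_len K i * pdot (mitre K i) (edge_dir K i)
    + pdot (psub p (vtx K (S i))) (mitre K i)); [rewrite E; lra|].
  unfold start_side; rewrite vtx_S.
  generalize (mitre K i), (edge_dir K i), (edge_len K i); unfold seg_pt; vec_eq.
Qed.

Lemma near_start_end_side i p : pdist p (vtx K i) <= r ->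
  pdot (psub p (vtx K i)) (edge_dir K i) <= 0 -> 0 < end_side K i p.
Proof.
  intros Hd H; destruct (dot_mitre_lower i _ Hd) as [_ H1].
  pose proof (edge_len_gt0 K HK i); pose proof (mitre_dot_prev_dir K HK i) as E.
  replace (end_side K i p) with (edge_len K i * pdot (mitre K (S i)) (edge_dir K i)
    - pdot (psub p (vtx K i)) (mitre K (S i))); [rewrite E; lra|].
  unfold end_side; rewrite vtx_S.
  generalize (mitre K (S i)), (edge_dir K i), (edge_len K i); unfold seg_pt; vec_eq.
Qed.

Lemma Tube_edge_edge_dist i p : Tube_edge K i r p <-> edge_dist K i p <= r.
Proof.
  split.
  - intros (q & Hq & Hd); apply (edge_dist_le i p) in Hq; lra.
  - intros H; exists (edge_foot i p); split; [apply edge_foot_on|auto].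
Qed.

Lemma edge_dist_sub_mod i p : edge_dist K (i mod n) p = edge_dist K i p.
Proof. apply edge_dist_mod, Nat.Div0.mod_mod. Qed.

(** Take the edge nearest to [p]. If [p] lies strictly beyond one of its mitre planes, no neighbour
    being nearer forces the foot to be the common vertex, and then [p] lies in the neighbouring
    piece. *)
Lemma Tube_piece p : Tube K r p <-> exists i, piece K i r p.
Proof.
  pose proof (size_ge3 K HK) as Hn; fold n in Hn; split.
  - intros (i0 & Hi0 & Hd); apply Tube_edge_edge_dist in Hd.
    destruct (finite_argmin (fun i => edge_dist K i p) n) as (i & Hi & Hmin); [lia|].
    assert (Hmin' : forall j, edge_dist K i p <= edge_dist K j p).
    { intros j; rewrite <- (edge_dist_sub_mod j); apply Hmin, Nat.mod_upper_bound; lia. }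
    assert (Hir : edge_dist K i p <= r) by (specialize (Hmin' i0); lra).
    destruct (Rle_lt_dec 0 (start_side K i p)) as [Ha|Ha].
    + destruct (Rle_lt_dec 0 (end_side K i p)) as [Hb|Hb]; [exists i; repeat split; auto|].
      destruct (edge_dist_next i p) as [H1 H2]; auto; [lra|]; specialize (H2 Hb (Hmin' _)).
      pose proof (edge_dist_foot i p) as E; rewrite H2 in E.
      assert (Hz : pdot (psub p (vtx K (S i))) (edge_dir K (S i)) <= 0).
      { apply nearest_start_dot; intros q Hq; apply (edge_dist_le _ p) in Hq.
        specialize (Hmin' (S i)); lra. }
      exists (S i); repeat split; [lra| |].
      * rewrite end_side_start_side in Hb; lra.
      * apply Rlt_le, near_start_end_side; [lra|auto].
    + pose proof (S_prev_mod K HK i) as Ei; set (j := prev_idx K i) in *.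
      assert (Hst : start_side K i p = start_side K (S j) p)
        by (unfold start_side; now rewrite (vtx_mod K _ _ Ei), (mitre_mod K HK _ _ Ei)).
      rewrite Hst in *; rewrite <- (edge_dist_mod K _ _ p Ei) in Hir, Hmin'.
      destruct (edge_dist_prev j p) as [H1 H2]; auto; [lra|]; specialize (H2 Ha (Hmin' _)).
      pose proof (edge_dist_foot (S j) p) as E; rewrite H2 in E.
      assert (Hz : 0 <= pdot (psub p (vtx K (S j))) (edge_dir K j)).
      { apply nearest_end_dot; intros q Hq; apply (edge_dist_le _ p) in Hq.
        specialize (Hmin' j); lra. }
      exists j; repeat split; [lra| |].
      * apply Rlt_le, near_end_start_side; [lra|auto].
      * rewrite end_side_start_side; lra.
  - intros (i & Hd & _); exists (i mod n)%nat; split; [apply Nat.mod_upper_bound; lia|].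
    apply Tube_edge_edge_dist; rewrite edge_dist_sub_mod; auto.
Qed.

Lemma start_side_pos_near i p : 0 < start_side K i p ->
  exists eps, 0 < eps /\ forall p', pdist p' p < eps -> 0 < start_side K i p'.
Proof.
  assert (E : forall q, start_side K i q = - pdot (vtx K i) (mitre K i) + pdot q (mitre K i))
    by (intros q; unfold start_side; rewrite pdot_psub_l; ring).
  rewrite E; intros H; apply dot_pos_near in H; destruct H as (eps & He & H).
  exists eps; split; auto; intros; rewrite E; auto.
Qed.

Lemma end_side_pos_near i p : 0 < end_side K i p ->
  exists eps, 0 < eps /\ forall p', pdist p' p < eps -> 0 < end_side K i p'.
Proof.
  assert (E : forall q, end_side K i q =
      pdot (vtx K (S i)) (mitre K (S i)) + pdot q (pscal (-1) (mitre K (S i))))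
    by (intros q; unfold end_side; rewrite pdot_psub_l, pdot_pscal_r; ring).
  rewrite E; intros H; apply dot_pos_near in H; destruct H as (eps & He & H).
  exists eps; split; auto; intros; rewrite E; auto.
Qed.

(** On the mitre plane the comparison of distances holds in both directions, so the two distances
    agree; the other side of the next piece is positive by [sides_sum_gt0]. *)
Lemma piece_next i p : edge_dist K i p <= r -> end_side K i p = 0 ->
  edge_dist K (S i) p = edge_dist K i p /\ piece K (S i) r p.
Proof.
  intros Hd He; destruct (edge_dist_next i p) as [H1 _]; auto; [lra|].
  rewrite end_side_start_side in He.
  destruct (edge_dist_prev i p) as [H2 _]; [lra|lra|].
  split; [lra|]; pose proof (sides_sum_gt0 (S i) p); repeat split; lra.
Qed.

Lemma piece_prev i p : edge_dist K (S i) p <= r -> start_side K (S i) p = 0 ->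
  edge_dist K (S i) p = edge_dist K i p /\ piece K i r p.
Proof.
  intros Hd He; destruct (edge_dist_prev i p) as [H1 _]; auto; [lra|].
  rewrite <- (Ropp_involutive (start_side K (S i) p)), <- end_side_start_side in He.
  destruct (edge_dist_next i p) as [H2 _]; [lra|lra|].
  split; [lra|]; pose proof (sides_sum_gt0 i p); repeat split; lra.
Qed.

Lemma pieces_meet_end i p : piece K i r p -> piece K (S i) r p ->
  end_side K i p = 0 /\ start_side K (S i) p = 0.
Proof. intros (_ & _ & H1) (_ & H2 & _); rewrite end_side_start_side in *; lra. Qed.

Lemma three_pieces_disjoint i p :
  piece K i r p -> piece K (S i) r p -> piece K (S (S i)) r p -> False.
Proof.
  intros H1 H2 H3.
  apply (pieces_meet_end i p) in H1; auto; apply (pieces_meet_end (S i) p) in H3; auto.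
  destruct H2 as [H2 _]; apply sides_sum_gt0 in H2; lra.
Qed.

(** A tube point near [p] may cross a mitre plane only if [p] lies on that plane, and then it enters
    a neighbour that also contains [p]. Using [edge_dist K (S i) p'] as the radius of the last piece
    records that its edge is no farther. *)
Lemma piece_local_cover i p : piece K (S i) r p ->
  exists eps, 0 < eps /\ forall p', pdist p' p < eps -> edge_dist K (S i) p' <= r ->
  exists k, (k = i \/ k = S i \/ k = S (S i)) /\
    piece K k r p /\ piece K k (edge_dist K (S i) p') p'.
Proof.
  intros Hp; pose proof Hp as (Hd & [Ha|Ha] & [Hb|Hb]).
  - destruct (start_side_pos_near (S i) p Ha) as (e1 & He1 & H1).
    destruct (end_side_pos_near (S i) p Hb) as (e2 & He2 & H2).
    exists (Rmin e1 e2); split; [now apply Rmin_glb_lt|]; intros p' Hp' _.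
    apply Rmin_Rgt in Hp'; exists (S i); split; [auto|split; auto].
    repeat split; [lra|apply Rlt_le, H1; lra|apply Rlt_le, H2; lra].
  - destruct (piece_next (S i) p Hd (eq_sym Hb)) as [_ Hn].
    assert (He : 0 < end_side K (S (S i)) p).
    { pose proof (end_side_start_side (S i) p); destruct Hn as [Hn _].
      apply sides_sum_gt0 in Hn; lra. }
    destruct (start_side_pos_near (S i) p Ha) as (e1 & He1 & H1).
    destruct (end_side_pos_near (S (S i)) p He) as (e2 & He2 & H2).
    exists (Rmin e1 e2); split; [now apply Rmin_glb_lt|]; intros p' Hp' Hr'.
    apply Rmin_Rgt in Hp'; destruct (Rle_lt_dec 0 (end_side K (S i) p')) as [Hc|Hc].
    + exists (S i); split; [auto|split; auto].
      repeat split; [lra|apply Rlt_le, H1; lra|auto].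
    + exists (S (S i)); split; [auto|split; auto].
      destruct (edge_dist_next (S i) p') as [H3 _]; auto; [lra|].
      rewrite end_side_start_side in Hc.
      repeat split; [lra|lra|apply Rlt_le, H2; lra].
  - destruct (piece_prev i p Hd (eq_sym Ha)) as [_ Hn].
    assert (He : 0 < start_side K i p).
    { pose proof Hn as (Hn' & _); apply sides_sum_gt0 in Hn'.
      rewrite end_side_start_side in Hn'; lra. }
    destruct (start_side_pos_near i p He) as (e1 & He1 & H1).
    destruct (end_side_pos_near (S i) p Hb) as (e2 & He2 & H2).
    exists (Rmin e1 e2); split; [now apply Rmin_glb_lt|]; intros p' Hp' Hr'.
    apply Rmin_Rgt in Hp'; destruct (Rle_lt_dec 0 (start_side K (S i) p')) as [Hc|Hc].
    + exists (S i); split; [auto|split; auto].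
      repeat split; [lra|auto|apply Rlt_le, H2; lra].
    + exists i; split; [auto|split; auto].
      destruct (edge_dist_prev i p') as [H3 _]; auto; [lra|].
      repeat split; [lra|apply Rlt_le, H1; lra|rewrite end_side_start_side; lra].
  - apply sides_sum_gt0 in Hd; lra.
Qed.

End LocalTube.

(** * Disjointness of far pieces *)

Lemma lim_pt_lipschitz (F : pt3 -> R) u l : (forall p q, F p <= F q + pdist p q) ->
  lim_pt u l -> is_lim_seq (fun n => F (u n)) (F l).
Proof.
  intros HF H; apply lim_pt_pdist in H; apply is_lim_seq_spec in H; apply is_lim_seq_spec.
  intros eps; destruct (H eps) as [N HN]; exists N; intros n Hn.
  specialize (HN n Hn); rewrite Rminus_0_r, Rabs_pos_eq in HN by apply pdist_ge0.
  pose proof (HF (u n) l); pose proof (HF l (u n)).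
  rewrite (pdist_sym l) in *; apply Rabs_def1; lra.
Qed.

Lemma finite_union_min {A : Type} (P : nat -> A -> Prop) (F : nat -> A -> R) :
  (forall k, (exists a, P k a) -> exists a, P k a /\ forall b, P k b -> F k a <= F k b) ->
  forall m, (exists k a, (k < m)%nat /\ P k a) ->
  exists k a, (k < m)%nat /\ P k a /\ forall k' b, (k' < m)%nat -> P k' b -> F k a <= F k' b.
Proof.
  intros H; induction m as [|m IH]; intros (k & a & Hk & Ha); [lia|].
  destruct (classic (exists a, P m a)) as [Hm|Hm].
  - destruct (H m Hm) as (b & Hb & Hbmin).
    destruct (classic (exists k a, (k < m)%nat /\ P k a)) as [Hm'|Hm'].
    + destruct (IH Hm') as (k1 & a1 & Hk1 & Ha1 & Hmin1).
      destruct (Rle_dec (F k1 a1) (F m b)) as [Hle|Hle%Rnot_le_lt].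
      * exists k1, a1; split; [lia|split; auto]; intros k' c Hk' Hc.
        destruct (Nat.eq_dec k' m) as [->|]; [specialize (Hbmin c Hc); lra|].
        apply Hmin1; auto; lia.
      * exists m, b; split; [lia|split; auto]; intros k' c Hk' Hc.
        destruct (Nat.eq_dec k' m) as [->|]; [auto|].
        assert (F k1 a1 <= F k' c) by (apply Hmin1; auto; lia); lra.
    + exists m, b; split; [lia|split; auto]; intros k' c Hk' Hc.
      destruct (Nat.eq_dec k' m) as [->|]; [auto|].
      exfalso; apply Hm'; exists k', c; split; auto; lia.
  - assert (Hkm : k <> m) by (intros ->; apply Hm; eauto).
    destruct IH as (k1 & a1 & Hk1 & Ha1 & Hmin1); [exists k, a; split; auto; lia|].
    exists k1, a1; split; [lia|split; auto]; intros k' c Hk' Hc.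
    destruct (Nat.eq_dec k' m) as [->|]; [exfalso; eauto|].
    apply Hmin1; auto; lia.
Qed.

(** * Turning points at local minima of the distance *)

Section Turning.
Context (K : polyknot) (HK : is_polyknot K).
Local Notation n := (pk_n K).

Lemma kparam_edge k t : 0 <= t <= 1 ->
  kparam K (INR k + t) = seg_pt (vtx K k) (edge_vec K k) t.
Proof.
  pose proof (size_ge3 K HK) as Hn.
  assert (Hlt : forall k t, 0 <= t < 1 ->
    kparam K (INR k + t) = seg_pt (vtx K k) (edge_vec K k) t).
  { clear k t; intros k t Ht.
    assert (E : Int_part (INR k + t) = Z.of_nat k)
      by (symmetry; apply Int_part_spec; rewrite <- INR_IZR_INZ; lra).
    unfold kparam; rewrite E, <- Nat2Z.inj_mod, Nat2Z.id, <- INR_IZR_INZ.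
    rewrite (vtx_mod K (k mod n) k), (vtx_mod K (S (k mod n)) (S k))
      by (try apply mod_S_eq; apply Nat.Div0.mod_mod).
    replace (INR k + t - INR k) with t by ring; unfold seg_pt, edge_vec; vec_eq. }
  (* At t = 1 the integer part jumps, so [kparam] reads the end of an edge as the start of the next
     one. *)
  intros [H0 [H1|H1]]; [auto|].
  rewrite H1; replace (INR k + 1) with (INR (S k) + 0) by (rewrite S_INR; ring).
  rewrite Hlt by lra; rewrite seg_pt_0; unfold seg_pt, edge_vec; vec_eq.
Qed.

(** Only the decreasing-then-increasing alternative of [turning_point] arises: on both branches
    leaving [y] the distance to [x] strictly grows. *)
Lemma turning_point_of_min x y s delta e1 e2 :
  0 < delta -> e1 <> (0, 0, 0) -> e2 <> (0, 0, 0) ->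
  (forall t, 0 <= t <= delta -> kparam K (s - t) = seg_pt y e1 t) ->
  (forall t, 0 <= t <= delta -> kparam K (s + t) = seg_pt y e2 t) ->
  pdot (psub x y) e1 <= 0 -> pdot (psub x y) e2 <= 0 -> turning_point K x y.
Proof.
  intros Hd He1 He2 H1 H2 Hx1 Hx2; exists s, delta; split; [|split; auto; right; split].
  - rewrite <- (seg_pt_0 y e1), <- H1 by lra; f_equal; ring.
  - intros u w Hu Huw Hw.
    replace u with (s - (s - u)) by ring; replace w with (s - (s - w)) by ring.
    rewrite !H1 by lra; apply seg_pt_pdist_lt; auto; lra.
  - intros u w Hu Huw Hw.
    replace u with (s + (u - s)) by ring; replace w with (s + (w - s)) by ring.
    rewrite !H2 by lra; apply seg_pt_pdist_lt; auto; lra.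
Qed.

Lemma opp_edge_vec_neq0 i : pscal (-1) (edge_vec K i) <> (0, 0, 0).
Proof.
  intros H; apply (edge_vec_neq0 K HK i); revert H; generalize (edge_vec K i).
  intros; coords; injection H as ? ? ?; split_pairs; lra.
Qed.

Lemma turning_point_interior i t x y : 0 < t < 1 -> y = seg_pt (vtx K i) (edge_vec K i) t ->
  (forall q, on_edge K i q -> pdist x y <= pdist x q) -> turning_point K x y.
Proof.
  intros Ht Hy Hmin.
  assert (Hd : 0 < Rmin t (1 - t)) by (apply Rmin_glb_lt; lra).
  pose proof (Rmin_l t (1 - t)); pose proof (Rmin_r t (1 - t)).
  apply (turning_point_of_min x y (INR i + t) (Rmin t (1 - t))
    (pscal (-1) (edge_vec K i)) (edge_vec K i)); auto.
  - apply opp_edge_vec_neq0.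
  - now apply edge_vec_neq0.
  - intros u Hu; replace (INR i + t - u) with (INR i + (t - u)) by ring.
    rewrite kparam_edge, Hy by lra; generalize (edge_vec K i); unfold seg_pt; vec_eq.
  - intros u Hu; replace (INR i + t + u) with (INR i + (t + u)) by ring.
    rewrite kparam_edge, Hy by lra; generalize (edge_vec K i); unfold seg_pt; vec_eq.
  - apply (nearest_pdot_le _ _ _ t); [lra|]; intros u Hu; apply Hmin.
    apply on_edge_seg_pt; exists (t - u); split; [lra|].
    rewrite Hy; generalize (edge_vec K i); unfold seg_pt; vec_eq.
  - apply (nearest_pdot_le _ _ _ (1 - t)); [lra|]; intros u Hu; apply Hmin.
    apply on_edge_seg_pt; exists (t + u); split; [lra|].
    rewrite Hy; generalize (edge_vec K i); unfold seg_pt; vec_eq.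
Qed.

Lemma turning_point_vertex i x :
  0 <= pdot (psub x (vtx K (S i))) (edge_dir K i) ->
  pdot (psub x (vtx K (S i))) (edge_dir K (S i)) <= 0 -> turning_point K x (vtx K (S i)).
Proof.
  intros H1 H2.
  (* The parameter [S i] keeps the incoming edge at nonnegative parameters, where [kparam_edge]
     applies; [delta = 1] covers both edges entirely. *)
  apply (turning_point_of_min x _ (INR (S i)) 1
    (pscal (-1) (edge_vec K i)) (edge_vec K (S i))); [lra|..].
  - apply opp_edge_vec_neq0.
  - now apply edge_vec_neq0.
  - intros u Hu; replace (INR (S i) - u) with (INR i + (1 - u)) by (rewrite S_INR; ring).
    rewrite kparam_edge by lra; unfold seg_pt, edge_vec; vec_eq.
  - intros u Hu; apply kparam_edge; lra.
  - rewrite edge_vec_dir by auto; expand_dot; pose proof (edge_len_gt0 K HK i).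
    rewrite pdot_psub_l in H1; nra.
  - rewrite edge_vec_dir by auto; rewrite pdot_pscal_r.
    pose proof (edge_len_gt0 K HK (S i)); nra.
Qed.

End Turning.

Section FarPieces.
Context (K : polyknot) (HK : is_polyknot K) (r : R) (Hr : Rbar_lt r (MinRad K)).
Local Notation n := (pk_n K).

Definition adj_or_eq (i j : nat) : Prop :=
  (i mod n = j mod n \/ S i mod n = j mod n \/
   i mod n = S j mod n)%nat.

Lemma S_mod_inj a b : (S a mod n = S b mod n)%nat -> (a mod n = b mod n)%nat.
Proof.
  intros H; apply (prev_mod K HK) in H.
  pose proof (prev_S_mod K HK a); pose proof (prev_S_mod K HK b); congruence.
Qed.

Lemma adj_or_eq_sym i j : adj_or_eq i j -> adj_or_eq j i.
Proof. unfold adj_or_eq; intuition congruence. Qed.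

Lemma adj_or_eq_S i : adj_or_eq i (S i).
Proof. unfold adj_or_eq; auto. Qed.

Lemma adj_or_eq_mod i i' j : (i mod n = i' mod n)%nat -> adj_or_eq i j -> adj_or_eq i' j.
Proof.
  unfold adj_or_eq; intros H; rewrite H, (mod_S_eq _ _ _ H); auto.
Qed.

(* The two mitre planes of a piece do not meet in the tube, so at most one neighbouring piece contains [p]. *)
Lemma adj_or_eq_trans_at p a b c : adj_or_eq a b -> adj_or_eq b c ->
  piece K a r p -> piece K b r p -> piece K c r p -> adj_or_eq a c.
Proof.
  assert (three : forall a b c, (S a mod n = b mod n)%nat -> (S b mod n = c mod n)%nat ->
    piece K a r p -> piece K b r p -> piece K c r p -> False).
  { clear a b c; intros a b c Hab Hbc Ha Hb Hc.
    apply (three_pieces_disjoint K HK r Hr a p); auto.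
    - now apply (piece_mod K HK b).
    - apply (piece_mod K HK c); auto; rewrite <- Hbc; symmetry; now apply mod_S_eq. }
  intros Hab Hbc Ha Hb Hc.
  destruct Hab as [E|[E|E]].
  - apply (adj_or_eq_mod b); [congruence|auto].
  - destruct Hbc as [E'|[E'|E']].
    + right; left; congruence.
    + exfalso; eapply (three a b c); eauto.
    + left; apply S_mod_inj; congruence.
  - destruct Hbc as [E'|[E'|E']].
    + right; right; rewrite E; now apply mod_S_eq.
    + left; congruence.
    + exfalso; eapply (three c b a); eauto.
Qed.

Lemma piece_local_cover_at i p : piece K i r p ->
  exists eps, 0 < eps /\ forall p', pdist p' p < eps -> edge_dist K i p' <= r ->
  exists k, adj_or_eq i k /\ piece K k r p /\ piece K k (edge_dist K i p') p'.
Proof.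
  pose proof (S_prev_mod K HK i) as E; set (j := prev_idx K i) in *.
  intros H; apply (piece_mod K HK i (S j)) in H; auto.
  destruct (piece_local_cover K HK r Hr j p H) as (eps & He & Hc).
  exists eps; split; auto; intros p' Hp' Hd.
  rewrite <- (edge_dist_mod K _ _ p' E) in *.
  destruct (Hc p' Hp' Hd) as (k & Hk & H1 & H2); exists k; split; auto.
  apply (adj_or_eq_mod (S j)); auto.
  destruct Hk as [-> |[-> | ->]]; unfold adj_or_eq; auto.
Qed.

(** * A hypothetical closest common point of far pieces *)

Definition overlap (i j : nat) (p : pt3) : Prop :=
  ~ adj_or_eq i j /\ piece K i r p /\ piece K j r p.

Definition reach (i j : nat) (p : pt3) : R := Rmax (edge_dist K i p) (edge_dist K j p).

Definition closest_overlap (i j : nat) (p : pt3) : Prop :=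
  overlap i j p /\ forall i' j' p', overlap i' j' p' -> reach i j p <= reach i' j' p'.

Lemma overlap_sym i j p : overlap i j p -> overlap j i p.
Proof. intros (H & ? & ?); split; [contradict H; now apply adj_or_eq_sym|auto]. Qed.

Lemma overlap_mod i i' j p : (i mod n = i' mod n)%nat -> overlap i j p -> overlap i' j p.
Proof.
  intros E (H & Hi & Hj); split; [contradict H|split; auto].
  - apply (adj_or_eq_mod i'); auto.
  - apply (piece_mod K HK i); auto.
Qed.

Lemma reach_sym i j p : reach i j p = reach j i p.
Proof. apply Rmax_comm. Qed.

Lemma closest_overlap_sym i j p : closest_overlap i j p -> closest_overlap j i p.
Proof.
  intros (H & Hmin); split; [now apply overlap_sym|].
  intros; rewrite reach_sym; auto.
Qed.

Lemma closest_overlap_mod i i' j p : (i mod n = i' mod n)%nat ->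
  closest_overlap i j p -> closest_overlap i' j p.
Proof.
  intros E (H & Hmin); split; [eapply overlap_mod; eauto|].
  intros; unfold reach; rewrite <- (edge_dist_mod K _ _ p E); apply (Hmin _ _ _ H0).
Qed.

Lemma edge_dist_lipschitz i p q : edge_dist K i p <= edge_dist K i q + pdist p q.
Proof. apply seg_dist_lipschitz. Qed.

Lemma lim_start_side i u l : lim_pt u l ->
  is_lim_seq (fun k => start_side K i (u k)) (start_side K i l).
Proof.
  intros H; unfold start_side; apply lim_pt_pdot; [apply lim_pt_psub|]; auto using lim_pt_const.
Qed.

Lemma lim_end_side i u l : lim_pt u l ->
  is_lim_seq (fun k => end_side K i (u k)) (end_side K i l).
Proof.
  intros H; unfold end_side; apply lim_pt_pdot; [apply lim_pt_psub|]; auto using lim_pt_const.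
Qed.

Lemma piece_closed i u l : (forall k, piece K i r (u k)) -> lim_pt u l -> piece K i r l.
Proof.
  intros H Hl; repeat split.
  - apply (lim_le_const (fun k => edge_dist K i (u k))); [|apply H].
    apply lim_pt_lipschitz; auto using edge_dist_lipschitz.
  - apply (lim_ge_const (fun k => start_side K i (u k))); [|apply H]; now apply lim_start_side.
  - apply (lim_ge_const (fun k => end_side K i (u k))); [|apply H]; now apply lim_end_side.
Qed.

Lemma pnorm_le_edge_dist i p :
  pnorm p <= edge_dist K i p + (edge_len K i + pnorm (vtx K i)).
Proof.
  pose proof (edge_foot_on K i p) as Hx; rewrite edge_dist_foot.
  apply (on_edge_seg_pt K) in Hx; destruct Hx as (t & Ht & Hx).
  set (x := edge_foot K i p) in *.
  replace p with (padd (psub p x) (padd (pscal t (edge_vec K i)) (vtx K i))) at 1.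
  2:{ rewrite Hx; generalize (edge_vec K i); unfold seg_pt; vec_eq. }
  eapply Rle_trans; [apply pnorm_padd|]; apply Rplus_le_compat_l.
  eapply Rle_trans; [apply pnorm_padd|]; apply Rplus_le_compat_r.
  rewrite pnorm_pscal, Rabs_pos_eq by lra; fold (edge_len K i).
  pose proof (edge_len_gt0 K HK i); nra.
Qed.

(** For each pair of indices the common points form a compact set and [reach] is continuous; by
    periodicity finitely many pairs of residues remain. *)
Lemma closest_overlap_exists i j p : overlap i j p -> exists i j p, closest_overlap i j p.
Proof.
  intros H0.
  assert (Hij : forall i j, (exists p, overlap i j p) ->
    exists p, overlap i j p /\ forall q, overlap i j q -> reach i j p <= reach i j q).
  { clear - HK; intros i j [p0 (Hf & Hp0)].
    destruct (compact_min_exists (fun p => piece K i r p /\ piece K j r p) (reach i j)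
       (r + (edge_len K i + pnorm (vtx K i)))) as (p & Hp & Hmin).
    - eauto.
    - intros p [[H _] _]; pose proof (pnorm_le_edge_dist i p); lra.
    - intros u l H Hl; split; eapply piece_closed; eauto; apply H.
    - intros u l; apply lim_pt_lipschitz; intros p q; unfold reach.
      pose proof (edge_dist_lipschitz i p q); pose proof (edge_dist_lipschitz j p q).
      pose proof (Rmax_l (edge_dist K i q) (edge_dist K j q)).
      pose proof (Rmax_r (edge_dist K i q) (edge_dist K j q)).
      apply Rmax_lub; lra.
    - intros p; eapply Rle_trans; [apply (seg_dist_ge0 (vtx K i) (vtx K (S i)) p)|apply Rmax_l].
    - exists p; split; [split; auto|]; intros q (_ & Hq); auto. }
  assert (Hn : (0 < n)%nat) by (pose proof (size_ge3 K HK); lia).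
  assert (Hb : forall a, (a mod n < n)%nat) by (intros; apply Nat.mod_upper_bound; lia).
  assert (Hred : forall i j p, overlap i j p -> overlap (i mod n) (j mod n) p /\
    reach (i mod n) (j mod n) p = reach i j p).
  { clear - HK; intros i j p H; split.
    - apply (overlap_mod i); [symmetry; apply Nat.Div0.mod_mod|].
      apply overlap_sym, (overlap_mod j); [symmetry; apply Nat.Div0.mod_mod|now apply overlap_sym].
    - unfold reach; f_equal; apply edge_dist_mod, Nat.Div0.mod_mod. }
  destruct (finite_union_min (fun i (jp : nat * pt3) => (fst jp < n)%nat /\ overlap i (fst jp) (snd jp))
     (fun i jp => reach i (fst jp) (snd jp))) with (m := n) as (i1 & [j1 p1] & _ & [_ H1] & Hmin).
  - intros i1 [[j1 p1] [Hj1 Hp1]]; simpl in *.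
    destruct (finite_union_min (overlap i1) (reach i1) (Hij i1)) with (m := n)
      as (j2 & p2 & Hj2 & H2 & Hmin); [eauto|].
    exists (j2, p2); split; auto; intros [j3 p3] [Hj3 Hp3]; simpl in *; auto.
  - exists (i mod n)%nat, ((j mod n)%nat, p); simpl; split; [apply Hb|split; [apply Hb|apply Hred, H0]].
  - exists i1, j1, p1; split; auto; intros i' j' p' H'.
    destruct (Hred i' j' p' H') as [H2 <-].
    apply (Hmin (i' mod n)%nat ((j' mod n)%nat, p')); simpl; auto.
Qed.

Lemma reach_le_r i j p : overlap i j p -> reach i j p <= r.
Proof. intros (_ & [H1 _] & [H2 _]); now apply Rmax_lub. Qed.

(** A point [p'] nearer to both edges would lie in pieces [k] and [l] that also contain [p].
    Adjacency is transitive among pieces through [p], so [k] and [l] are still far apart and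
    contradict minimality. *)
Lemma closest_overlap_isolated i j p : closest_overlap i j p ->
  exists eps, 0 < eps /\ forall p', pdist p' p < eps ->
    edge_dist K i p' < reach i j p -> edge_dist K j p' < reach i j p -> False.
Proof.
  intros [Ho Hmin]; pose proof Ho as (Hf & Hi & Hj); pose proof (reach_le_r _ _ _ Ho) as Hrr.
  destruct (piece_local_cover_at i p Hi) as (e1 & He1 & H1).
  destruct (piece_local_cover_at j p Hj) as (e2 & He2 & H2).
  exists (Rmin e1 e2); split; [now apply Rmin_glb_lt|]; intros p' Hp' Hdi Hdj.
  apply Rmin_Rgt in Hp'.
  destruct (H1 p') as (k & Hk & Hkp & Hkp'); [lra..|].
  destruct (H2 p') as (l & Hl & Hlp & Hlp'); [lra..|].
  assert (Hkl : ~ adj_or_eq k l).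
  { intros Hkl; apply Hf.
    apply (adj_or_eq_trans_at p i k j); auto.
    apply (adj_or_eq_trans_at p k l j); auto using adj_or_eq_sym. }
  assert (Ho' : overlap k l p').
  { destruct Hkp' as (? & ? & ?), Hlp' as (? & ? & ?); split; [auto|repeat split; auto; lra]. }
  specialize (Hmin _ _ _ Ho'); unfold reach at 2 in Hmin.
  destruct Hkp' as [? _], Hlp' as [? _].
  assert (Rmax (edge_dist K k p') (edge_dist K l p') < reach i j p)
    by (apply Rmax_lub_lt; lra); lra.
Qed.

Definition is_foot (i : nat) (p x : pt3) : Prop :=
  on_edge K i x /\ pdist p x = edge_dist K i p.

Definition mid (x y : pt3) : pt3 := pscal (/ 2) (padd x y).

Lemma pdist_mid_l x y : pdist x (mid x y) = pdist x y / 2.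
Proof.
  unfold pdist; replace (psub x (mid x y)) with (pscal (/ 2) (psub x y)).
  - rewrite pnorm_pscal, Rabs_pos_eq; lra.
  - unfold mid; coords; split_pairs; field.
Qed.

Lemma mid_comm x y : mid x y = mid y x.
Proof. unfold mid; vec_eq. Qed.

Lemma pdist_mid_r x y : pdist y (mid x y) = pdist x y / 2.
Proof. rewrite mid_comm, pdist_mid_l, pdist_sym; auto. Qed.

(** If x and y were less than twice [reach] apart, a small move of [p] towards their midpoint would
    bring it nearer than [reach] to both edges. Equality then places [p] at the midpoint. *)
Lemma closest_overlap_mid i j p x y : closest_overlap i j p -> is_foot i p x -> is_foot j p y ->
  pdist x y = 2 * reach i j p /\ p = mid x y.
Proof.
  intros Hc [Hx Hpx] [Hy Hpy].
  destruct (closest_overlap_isolated i j p Hc) as (eps & He & Hiso).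
  assert (H1 : pdist p x <= reach i j p) by (rewrite Hpx; apply Rmax_l).
  assert (H2 : pdist p y <= reach i j p) by (rewrite Hpy; apply Rmax_r).
  set (rho := reach i j p) in *.
  assert (Hxy : pdist x y = 2 * rho).
  { apply Rle_antisym; [pose proof (pdist_triangle x p y); rewrite (pdist_sym x p) in *; lra|].
    apply Rnot_lt_le; intros Hlt.
    pose proof (pdist_ge0 (mid x y) p) as Hm0.
    set (t := Rmin 1 (eps / (2 * (pdist (mid x y) p + 1)))).
    assert (Ht : 0 < t <= 1).
    { split; [|apply Rmin_l]; apply Rmin_glb_lt; [lra|apply Rdiv_lt_0_compat; lra]. }
    assert (Ht2 : t * pdist (mid x y) p < eps).
    { apply Rle_lt_trans with (eps / (2 * (pdist (mid x y) p + 1)) * (pdist (mid x y) p + 1)).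
      - apply Rmult_le_compat; try lra; apply Rmin_r.
      - replace (_ * _) with (eps / 2) by (field; lra); lra. }
    assert (Hconv : forall q, padd (pscal (1 - t) q) (pscal t q) = q) by (intros; vec_eq).
    apply (Hiso (padd (pscal (1 - t) p) (pscal t (mid x y)))).
    - rewrite <- (Hconv p) at 2.
      eapply Rle_lt_trans; [apply pdist_convex; lra|]; rewrite pdist_self; lra.
    - eapply Rle_lt_trans; [apply (edge_dist_le K i _ x Hx)|].
      rewrite <- (Hconv x) at 2.
      eapply Rle_lt_trans; [apply pdist_convex; lra|].
      rewrite (pdist_sym (mid x y) x), pdist_mid_l; nra.
    - eapply Rle_lt_trans; [apply (edge_dist_le K j _ y Hy)|].
      rewrite <- (Hconv y) at 2.
      eapply Rle_lt_trans; [apply pdist_convex; lra|].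
      rewrite (pdist_sym (mid x y) y), pdist_mid_r; nra. }
  split; auto.
  apply pdist_eq0.
  (* The median formula in the triangle p, x, y; the right-hand side is at most 0 here. *)
  assert (E : pdist p (mid x y) * pdist p (mid x y) =
    (pdist p x * pdist p x + pdist p y * pdist p y) / 2 - pdist x y * pdist x y / 4).
  { rewrite !pdist_sqr; unfold mid; coords; field. }
  pose proof (pdist_ge0 p (mid x y)); pose proof (pdist_ge0 p x); pose proof (pdist_ge0 p y).
  rewrite Hxy in E; nra.
Qed.

(** A point of the edge nearer to [x] would let [y] move slightly towards it; the midpoint of [x]
    and the moved point is near [p] and nearer than [reach] to both edges. *)
Lemma closest_overlap_local_min i j p x y : closest_overlap i j p ->
  is_foot i p x -> is_foot j p y -> forall q, on_edge K j q -> pdist x y <= pdist x q.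
Proof.
  intros Hc Hx Hy q Hq; apply Rnot_lt_le; intros Hlt.
  destruct (closest_overlap_mid i j p x y Hc Hx Hy) as [Hxy Hp].
  destruct (closest_overlap_isolated i j p Hc) as (eps & He & Hiso).
  set (rho := reach i j p) in *; destruct Hx as [Hx _], Hy as [Hy _].
  pose proof (pdist_ge0 q y) as H0.
  set (t := Rmin 1 (eps / (pdist q y + 1))).
  assert (Ht : 0 < t <= 1).
  { split; [|apply Rmin_l]; apply Rmin_glb_lt; [lra|apply Rdiv_lt_0_compat; lra]. }
  assert (Ht2 : t * pdist q y <= eps).
  { apply Rle_trans with (eps / (pdist q y + 1) * (pdist q y + 1)).
    - apply Rmult_le_compat; try lra; apply Rmin_r.
    - right; field; lra. }
  assert (Hconv : forall z, padd (pscal (1 - t) z) (pscal t z) = z) by (intros; vec_eq).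
  set (y' := padd (pscal (1 - t) y) (pscal t q)).
  assert (Hy' : on_edge K j y') by (apply on_seg_convex; auto; lra).
  assert (Hxy' : pdist x y' < 2 * rho).
  { rewrite <- (Hconv x); eapply Rle_lt_trans; [apply pdist_convex; lra|]; nra. }
  apply (Hiso (mid x y')).
  - rewrite Hp; unfold pdist.
    replace (psub (mid x y') (mid x y)) with (pscal (t / 2) (psub q y))
      by (unfold mid, y'; coords; split_pairs; field).
    rewrite pnorm_pscal, Rabs_pos_eq by lra; fold (pdist q y); lra.
  - eapply Rle_lt_trans; [apply (edge_dist_le K i _ x Hx)|].
    rewrite pdist_sym, pdist_mid_l; lra.
  - eapply Rle_lt_trans; [apply (edge_dist_le K j _ y' Hy')|].
    rewrite pdist_sym, pdist_mid_r; lra.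
Qed.

(** A point on a mitre section belongs equally to the neighbouring piece; minimality along both
    edges at a vertex comes from this exchange. *)
Lemma closest_overlap_reindex i j k p : closest_overlap i j p -> adj_or_eq j k ->
  piece K k r p -> edge_dist K k p = edge_dist K j p -> closest_overlap i k p.
Proof.
  intros [(Hf & Hi & Hj) Hmin] Hjk Hk E; split; [split; [|auto]|].
  - contradict Hf; apply (adj_or_eq_trans_at p i k j); auto using adj_or_eq_sym.
  - unfold reach at 1; rewrite E; exact Hmin.
Qed.

Lemma mid_sub_dot x y d : pdot (psub x y) d = 2 * pdot (psub (mid x y) y) d.
Proof. unfold mid; coords; field. Qed.

(** Minimality along the edge [j] controls the incoming direction only. For the outgoing one:
    strictly inside the mitre plane, (p-v).(d+d') < 0 while (p-v).d >= 0, hence (p-v).d' < 0; on the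
    plane, [p] is reassigned to the next piece. *)
Lemma closest_overlap_turning_end i j p x : closest_overlap i j p ->
  is_foot i p x -> is_foot j p (vtx K (S j)) -> turning_point K x (vtx K (S j)).
Proof.
  intros Hc Hx Hy; destruct (closest_overlap_mid _ _ _ _ _ Hc Hx Hy) as [_ Hp].
  apply turning_point_vertex; auto.
  - apply nearest_end_dot; auto; apply (closest_overlap_local_min i j p); auto.
  - pose proof Hc as [(_ & _ & Hj) _]; pose proof Hj as (Hjd & _ & [Hs|Hs]).
    + rewrite mid_sub_dot, <- Hp.
      destruct (mitre_S_scal K HK j) as (k & Hk & Hm).
      unfold end_side in Hs; rewrite Hm, pdot_pscal_r in Hs.
      assert (H1 : 0 <= pdot (psub p (vtx K (S j))) (edge_dir K j)).
      { apply nearest_end_dot; auto; intros q Hq; apply (edge_dist_le _ _ p) in Hq.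
        destruct Hy as [_ Hy]; lra. }
      assert (H2 : 0 < pdot (psub (vtx K (S j)) p) (padd (edge_dir K j) (edge_dir K (S j)))) by nra.
      replace (pdot (psub (vtx K (S j)) p) (padd (edge_dir K j) (edge_dir K (S j))))
        with (- pdot (psub p (vtx K (S j))) (edge_dir K j) - pdot (psub p (vtx K (S j))) (edge_dir K (S j)))
        in H2 by (generalize (edge_dir K j), (edge_dir K (S j)); vec_eq).
      lra.
    + destruct (piece_next K HK r Hr j p Hjd (eq_sym Hs)) as [E Hn].
      apply nearest_start_dot; auto.
      apply (closest_overlap_local_min i (S j) p); auto.
      * apply (closest_overlap_reindex i j); auto; apply adj_or_eq_S.
      * destruct Hy as [_ Hy]; split; [|congruence].
        apply on_edge_seg_pt; exists 0; split; [lra|symmetry; apply seg_pt_0].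
Qed.

Lemma closest_overlap_turning_start i j p x : closest_overlap i (S j) p ->
  is_foot i p x -> is_foot (S j) p (vtx K (S j)) -> turning_point K x (vtx K (S j)).
Proof.
  intros Hc Hx Hy; destruct (closest_overlap_mid _ _ _ _ _ Hc Hx Hy) as [_ Hp].
  apply turning_point_vertex; auto.
  - pose proof Hc as [(_ & _ & Hj) _]; pose proof Hj as (Hjd & [Hs|Hs] & _).
    + rewrite mid_sub_dot, <- Hp.
      destruct (mitre_S_scal K HK j) as (k & Hk & Hm).
      unfold start_side in Hs; rewrite Hm, pdot_pscal_r in Hs.
      assert (H1 : pdot (psub p (vtx K (S j))) (edge_dir K (S j)) <= 0).
      { apply nearest_start_dot; auto; intros q Hq; apply (edge_dist_le _ _ p) in Hq.
        destruct Hy as [_ Hy]; lra. }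
      rewrite pdot_padd_r in Hs.
      assert (H2 : 0 < pdot (psub p (vtx K (S j))) (edge_dir K j) +
        pdot (psub p (vtx K (S j))) (edge_dir K (S j))) by nra.
      lra.
    + destruct (piece_prev K HK r Hr j p Hjd (eq_sym Hs)) as [E Hn].
      apply nearest_end_dot; auto.
      apply (closest_overlap_local_min i j p); auto.
      * apply (closest_overlap_reindex i (S j)); auto; apply adj_or_eq_sym, adj_or_eq_S.
      * destruct Hy as [_ Hy]; split; [|congruence].
        apply on_edge_seg_pt; exists 1; split; [lra|unfold seg_pt, edge_vec; vec_eq].
  - apply nearest_start_dot; auto; apply (closest_overlap_local_min i (S j) p); auto.
Qed.

Lemma closest_overlap_turning i j p x y : closest_overlap i j p ->
  is_foot i p x -> is_foot j p y -> turning_point K x y.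
Proof.
  intros Hc Hx Hy; pose proof Hy as [Hyj Hpy].
  apply on_edge_seg_pt in Hyj; destruct Hyj as (t & [[Ht0|Ht0] [Ht1|Ht1]] & Hyt).
  - apply (turning_point_interior K HK j t); auto.
    apply (closest_overlap_local_min i j p); auto.
  - assert (E : y = vtx K (S j)) by (rewrite Hyt, Ht1; unfold seg_pt, edge_vec; vec_eq).
    rewrite E in *; apply (closest_overlap_turning_end i j p); auto.
  - rewrite <- Ht0, seg_pt_0 in Hyt.
    pose proof (S_prev_mod K HK j) as Ej; set (k := prev_idx K j) in *.
    assert (E : y = vtx K (S k)) by (rewrite Hyt; symmetry; now apply vtx_mod).
    rewrite E in *; apply (closest_overlap_turning_start i k p); auto.
    + apply closest_overlap_sym, (closest_overlap_mod j); auto using closest_overlap_sym.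
    + split; [|now rewrite (edge_dist_mod K _ _ p Ej)].
      apply on_edge_seg_pt; exists 0; split; [lra|symmetry; apply seg_pt_0].
  - lra.
Qed.

Lemma on_edge_on_knot i x : on_edge K i x -> on_knot K x.
Proof.
  intros H; exists (i mod n)%nat; split.
  - apply Nat.mod_upper_bound; pose proof (size_ge3 K HK); lia.
  - unfold on_edge; rewrite (vtx_mod K (i mod n) i), (vtx_mod K (S (i mod n)) (S i));
      auto; [apply mod_S_eq|]; apply Nat.Div0.mod_mod.
Qed.

Lemma far_pieces_disjoint i j p : Rbar_lt r (Rbar_mult (/ 2) (dcsd K)) ->
  piece K i r p -> piece K j r p -> adj_or_eq i j.
Proof.
  intros Hd Hi Hj; apply NNPP; intros Hf.
  destruct (closest_overlap_exists i j p) as (i1 & j1 & p1 & Hc); [split; auto|].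
  clear i j p Hi Hj Hf; set (x := edge_foot K i1 p1); set (y := edge_foot K j1 p1).
  assert (Hx : is_foot i1 p1 x) by (split; [apply edge_foot_on|reflexivity]).
  assert (Hy : is_foot j1 p1 y) by (split; [apply edge_foot_on|reflexivity]).
  destruct (closest_overlap_mid _ _ _ _ _ Hc Hx Hy) as [Hxy _].
  pose proof Hc as [Ho _]; apply reach_le_r in Ho.
  assert (Hdc : DC K x y).
  { split; [eapply on_edge_on_knot, Hx|]; split; [eapply on_edge_on_knot, Hy|]; split; [|split].
    (* Equal feet would be a common point of two edges, making the edges equal or adjacent. *)
    - intros E; destruct Hc as [(Hf & _) _]; apply Hf.
      destruct (classic (i1 mod n = j1 mod n)%nat) as [|Hne]; [left; auto|].
      destruct (edges_meet K HK i1 j1 x Hne (proj1 Hx)) as [[]|[]];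
        [rewrite E; apply Hy|right; left; auto|right; right; auto].
    - apply (closest_overlap_turning j1 i1 p1); auto using closest_overlap_sym.
    - apply (closest_overlap_turning i1 j1 p1); auto. }
  destruct (Glb_Rbar_correct (fun d => exists x y, DC K x y /\ d = pdist x y)) as [Hlb _].
  specialize (Hlb (pdist x y) (ex_intro _ x (ex_intro _ y (conj Hdc eq_refl)))); fold (dcsd K) in Hlb.
  (* A finite [dcsd] is at most [pdist x y <= 2 * r]; it cannot be infinite because [DC] contains a
     pair, and minus infinity has no real number below its half. *)
  destruct (dcsd K) as [d| |].
  - simpl in *; lra.
  - exact Hlb.
  - revert Hd; unfold Rbar_mult, Rbar_mult'.
    destruct Rle_dec as [Hle|]; [|lra]; destruct Rle_lt_or_eq_dec; simpl; lra || tauto.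
Qed.

End FarPieces.

(** * Coordinates on the slices *)

Lemma exists_orthogonal (b : pt3) : exists m, m <> (0, 0, 0) /\ pdot m b = 0.
Proof.
  destruct b as [[x y] z].
  destruct (classic (x = 0 /\ y = 0)) as [[-> ->]|H].
  - exists (1, 0, 0); split; [intros E; injection E; lra|simpl; ring].
  - exists (y, - x, 0); split; [|simpl; ring].
    intros E; injection E as E1 E2; apply H; lra.
Qed.

Lemma triple_cross a b c : pcross a (pcross b c) = psub (pscal (pdot a c) b) (pscal (pdot a b) c).
Proof. vec_eq. Qed.

(** The cross product works unless it vanishes. If it does and [a] is nonzero, expanding the triple
    product shows [b] parallel to [a], so any vector orthogonal to [a] serves. *)
Lemma exists_orthogonal2 (a b : pt3) :
  exists m, m <> (0, 0, 0) /\ pdot m a = 0 /\ pdot m b = 0.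
Proof.
  destruct (classic (pcross a b = (0, 0, 0))) as [E|E].
  - destruct (classic (a = (0, 0, 0))) as [->|Ha].
    + destruct (exists_orthogonal b) as (m & Hm & H); exists m; repeat split; auto.
      coords; ring.
    + destruct (exists_orthogonal a) as (m & Hm & H); exists m; repeat split; auto.
      pose proof (triple_cross a a b) as T; rewrite E in T.
      assert (T' : pdot m (pcross a (0, 0, 0)) = 0) by vec_eq.
      rewrite T, pdot_psub_r, !pdot_pscal_r, H in T'.
      assert (pdot a a <> 0) by (intros E'; apply Ha, pdot_self_eq0, E').
      apply Rmult_eq_reg_l with (pdot a a); auto; lra.
  - exists (pcross a b); repeat split; auto; vec_eq.
Qed.

Lemma perturb_nonzero (w u : pt3) (m : nat -> pt3) k :
  (forall i, (i < k)%nat -> pdot w (m i) <> 0) ->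
  exists delta, 0 < delta /\ forall t i, 0 < t < delta -> (i < k)%nat ->
    pdot (padd w (pscal t u)) (m i) <> 0.
Proof.
  induction k as [|k IH]; intros H.
  - exists 1; split; [lra|]; intros; lia.
  - destruct IH as (d & Hd & IH); [auto|].
    set (c := Rabs (pdot w (m k))); set (e := Rabs (pdot u (m k))).
    assert (Hc : 0 < c) by (apply Rabs_pos_lt, H; lia).
    assert (He : 0 <= e) by apply Rabs_pos.
    exists (Rmin d (c / (e + 1))); split.
    { apply Rmin_glb_lt; [auto|apply Rdiv_lt_0_compat; lra]. }
    intros t i [Ht0 Ht] Hi; apply Rmin_Rgt in Ht.
    destruct (Nat.eq_dec i k) as [->|]; [|apply IH; [lra|lia]].
    rewrite pdot_padd_l, pdot_pscal_l; intros E.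
    assert (Ec : c = t * e).
    { unfold c, e; rewrite <- (Rabs_pos_eq t) at 1 by lra; rewrite <- Rabs_mult.
      replace (pdot w (m k)) with (- (t * pdot u (m k))) by lra; apply Rabs_Ropp. }
    assert (t * (e + 1) < c); [|nra].
    destruct Ht as [_ Ht]; apply Rgt_lt in Ht.
    apply Rmult_lt_compat_r with (r := e + 1) in Ht; [|lra].
    unfold Rdiv in Ht; rewrite Rmult_assoc, Rinv_l in Ht; lra.
Qed.

(** Finitely many planes do not cover space: a vector lying on the next plane is pushed off it along
    its normal, by so little that it stays off the earlier ones. *)
Lemma exists_generic_vector (m : nat -> pt3) k : (forall i, (i < k)%nat -> m i <> (0, 0, 0)) ->
  exists w, forall i, (i < k)%nat -> pdot w (m i) <> 0.
Proof.
  induction k as [|k IH]; intros H; [exists (0, 0, 0); intros; lia|].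
  destruct IH as (w & Hw); [auto|].
  destruct (perturb_nonzero w (m k) m k Hw) as (d & Hd & Hp).
  assert (Hk : pdot (m k) (m k) <> 0) by (intros E; apply (H k); [lia|now apply pdot_self_eq0]).
  destruct (Req_dec (pdot w (m k)) 0) as [E|E].
  - exists (padd w (pscal (d / 2) (m k))); intros i Hi.
    destruct (Nat.eq_dec i k) as [->|]; [|apply Hp; [lra|lia]].
    rewrite pdot_padd_l, pdot_pscal_l, E, Rplus_0_l.
    apply Rmult_integral_contrapositive; split; [lra|auto].
  - exists w; intros i Hi; destruct (Nat.eq_dec i k) as [->|]; [auto|apply Hw; lia].
Qed.

(** A multiple of [v] would be orthogonal to [m], and [w] is not. *)
Lemma pcross_neq0 w v m : v <> (0, 0, 0) -> pdot m v = 0 -> pdot w m <> 0 ->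
  pcross w v <> (0, 0, 0).
Proof.
  intros Hv Hmv Hwm E.
  assert (T : pdot m (pcross v (pcross w v)) = pdot v v * pdot w m - pdot v w * pdot m v)
    by vec_eq.
  rewrite E, Hmv in T; replace (pdot m (pcross v (0, 0, 0))) with 0 in T by vec_eq.
  assert (pdot v v <> 0) by (intros E'; apply Hv, pdot_self_eq0, E').
  assert (pdot v v * pdot w m <> 0) by (apply Rmult_integral_contrapositive; auto); lra.
Qed.

(** [w] need not be orthogonal to [v], yet its product together with that of [pcross w v] determines
    a vector of the plane orthogonal to [v]: here [q] is both parallel and orthogonal to the nonzero
    [pcross w v]. *)
Lemma frame_injective w v q : pcross w v <> (0, 0, 0) ->
  pdot q v = 0 -> pdot w q = 0 -> pdot (pcross w v) q = 0 -> q = (0, 0, 0).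
Proof.
  intros Hy H1 H2 H3; apply pdot_self_eq0.
  pose proof (lagrange_identity q (pcross w v)) as L.
  assert (E : pcross q (pcross w v) = (0, 0, 0)).
  { rewrite triple_cross, H1, (pdot_comm q w), H2; vec_eq. }
  rewrite E, (pdot_comm q (pcross w v)), H3 in L; simpl in L.
  assert (pdot (pcross w v) (pcross w v) <> 0) by (intros E'; apply Hy, pdot_self_eq0, E').
  apply Rmult_eq_reg_r with (pdot (pcross w v) (pcross w v)); auto; lra.
Qed.

Lemma frame_surjective w v c d : pcross w v <> (0, 0, 0) ->
  exists q, pdot q v = 0 /\ pdot w q = c /\ pdot (pcross w v) q = d.
Proof.
  intros Hy; set (y := pcross w v) in *.
  assert (Hyy : pdot y y <> 0) by (intros E'; apply Hy, pdot_self_eq0, E').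
  (* [y] and [pcross y v] span the plane orthogonal to [v]; the minus sign comes from w.(y x v) =
     -|y|^2. *)
  exists (pscal (/ pdot y y) (psub (pscal d y) (pscal c (pcross y v)))).
  rewrite pdot_pscal_l, !pdot_pscal_r, pdot_psub_l, !pdot_psub_r, !pdot_pscal_l, !pdot_pscal_r.
  replace (pdot y v) with 0 by (unfold y; vec_eq).
  replace (pdot (pcross y v) v) with 0 by vec_eq.
  replace (pdot w y) with 0 by (unfold y; vec_eq).
  replace (pdot w (pcross y v)) with (- pdot y y) by (unfold y; vec_eq).
  replace (pdot y (pcross y v)) with 0 by vec_eq.
  repeat split; field; auto.
Qed.

Lemma same_ray c d x y : 0 < x * x + y * y -> c * y = d * x -> 0 <= c * x + d * y ->
  exists k, 0 <= k /\ c = k * x /\ d = k * y.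
Proof.
  intros H0 H1 H2; exists ((c * x + d * y) / (x * x + y * y)); split; [|split].
  - apply Rdiv_le_0_compat; auto.
  - apply Rmult_eq_reg_r with (x * x + y * y); [|lra].
    replace (_ / _ * _ * _) with ((c * x + d * y) * x) by (field; lra).
    replace ((c * x + d * y) * x) with (c * (x * x) + (d * x) * y) by ring.
    rewrite <- H1; ring.
  - apply Rmult_eq_reg_r with (x * x + y * y); [|lra].
    replace (_ / _ * _ * _) with ((c * x + d * y) * y) by (field; lra).
    replace ((c * x + d * y) * y) with ((c * y) * x + d * (y * y)) by ring.
    rewrite H1; ring.
Qed.

Lemma cos_sin_eq x y : cos x = cos y -> sin x = sin y -> exists k, x - y = IZR k * (2 * PI).
Proof.
  intros Hc Hs.
  assert (H : cos (x - y) = 1).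
  { rewrite cos_minus, Hc, Hs; pose proof (sin2_cos2 y); unfold Rsqr in *; lra. }
  replace (x - y) with (2 * ((x - y) / 2)) in H by field.
  rewrite cos_2a_sin in H.
  assert (H0 : sin ((x - y) / 2) = 0) by nra.
  apply sin_eq_0_0 in H0; destruct H0 as [k Hk]; exists k; lra.
Qed.

Lemma circle_angle a b : a * a + b * b = 1 ->
  exists t, 0 <= t <= 2 * PI /\ a = cos t /\ b = sin t.
Proof.
  intros H; assert (Ha : -1 <= a <= 1) by nra.
  pose proof (acos_bound a) as Hb; pose proof (cos_acos a Ha) as Hc.
  pose proof (sin2_cos2 (acos a)) as Hs; unfold Rsqr in Hs; rewrite Hc in Hs.
  assert (Hs0 : 0 <= sin (acos a)) by (apply sin_ge_0; lra).
  destruct (Rle_lt_dec 0 b).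
  - exists (acos a); repeat split; [lra|lra|auto|nra].
  - exists (2 * PI - acos a); repeat split; [lra|lra| |].
    + rewrite cos_minus, cos_2PI, sin_2PI, Hc; ring.
    + rewrite sin_minus, cos_2PI, sin_2PI; nra.
Qed.

Lemma nat_plus_fraction (x : R) (m : nat) : (0 < m)%nat -> 0 <= x <= INR m ->
  exists i s, (i < m)%nat /\ 0 <= s <= 1 /\ x = INR i + s.
Proof.
  induction m as [|m IH]; intros Hm Hx; [lia|].
  rewrite S_INR in Hx; destruct (Rle_lt_dec (INR m) x).
  - exists m, (x - INR m); repeat split; [lia|lra|lra|ring].
  - destruct m as [|m]; [simpl in *; lra|].
    destruct IH as (i & s & Hi & Hs & E); [lia|lra|]; exists i, s; split; [lia|auto].
Qed.

Lemma finite_common_delta (P : nat -> R -> Prop) m :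
  (forall i a b, 0 < b <= a -> P i a -> P i b) ->
  (forall i, (i < m)%nat -> exists d, 0 < d /\ P i d) ->
  exists d, 0 < d /\ forall i, (i < m)%nat -> P i d.
Proof.
  intros Hmon; induction m as [|m IH]; intros H; [exists 1; split; [lra|intros; lia]|].
  destruct IH as (d1 & Hd1 & H1); [auto|]; destruct (H m) as (d2 & Hd2 & H2); [lia|].
  assert (0 < Rmin d1 d2) by (now apply Rmin_glb_lt).
  exists (Rmin d1 d2); split; auto; intros i Hi.
  destruct (Nat.eq_dec i m) as [->|].
  - apply (Hmon m d2); auto; split; auto; apply Rmin_r.
  - apply (Hmon i d1); [split; auto; apply Rmin_l|apply H1; lia].
Qed.

(** * Tube coordinates along an edge and their gluing *)

Section Coordinates.
Context (K : polyknot) (HK : is_polyknot K) (r : R) (Hr0 : 0 < r) (Hr : Rbar_lt r (MinRad K)).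
Local Notation n := (pk_n K).

Definition core_pt (i : nat) (s : R) : pt3 := seg_pt (vtx K i) (edge_vec K i) s.

Definition slice_normal (i : nat) (s : R) : pt3 :=
  padd (pscal (1 - s) (mitre K i)) (pscal s (mitre K (S i))).

(* The planes through [core_pt i s] with normal [slice_normal i s] form the pencil spanned by the two mitre
   planes of the edge.  In each of them [w] and [pcross w N] serve as linear coordinates; [(c, d)] has the
   direction of these coordinates and the distance to the edge, divided by [r], as its length.  Written
   without division, the relation is visibly closed. *)
Definition tube_coord (w : pt3) (i : nat) (s : R) (p : pt3) (c d : R) : Prop :=
  let q := psub p (core_pt i s) in
  let N := slice_normal i s in
  0 <= s <= 1 /\ edge_dist K i p <= r /\ pdot q N = 0 /\
  r * r * (c * c + d * d) = edge_dist K i p * edge_dist K i p /\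
  c * pdot (pcross w N) q = d * pdot w q /\
  0 <= c * pdot w q + d * pdot (pcross w N) q.

Lemma slice_normal_dir i s : pdot (edge_dir K i) (slice_normal i s) = 1.
Proof.
  unfold slice_normal; rewrite pdot_comm; expand_dot.
  rewrite mitre_dot_dir, mitre_dot_prev_dir by auto; ring.
Qed.

(** The slice equation is affine in the two side functions: the remaining term s(1-s)l(m'.d - m.d)
    vanishes because both mitre normals have product 1 with the edge direction. *)
Lemma slice_dot i s p : pdot (psub p (core_pt i s)) (slice_normal i s) =
  (1 - s) * start_side K i p - s * end_side K i p.
Proof.
  pose proof (mitre_dot_dir K HK i) as E1; pose proof (mitre_dot_prev_dir K HK i) as E2.
  unfold core_pt, slice_normal, start_side, end_side; rewrite vtx_S, edge_vec_dir by auto.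
  assert (E3 : pdot (mitre K i) (edge_dir K i) = pdot (mitre K (S i)) (edge_dir K i)) by congruence.
  clear E1 E2; revert E3; generalize (mitre K i), (mitre K (S i)), (edge_dir K i), (edge_len K i), (vtx K i).
  intros m m' d l v E3.
  transitivity ((1 - s) * pdot (psub p v) m - s * pdot (psub (seg_pt v d l) p) m'
    + s * l * (1 - s) * (pdot m' d - pdot m d)).
  - clear E3; unfold seg_pt; vec_eq.
  - rewrite E3; ring.
Qed.

Lemma core_pt_on_edge i s : 0 <= s <= 1 -> on_edge K i (core_pt i s).
Proof. intros H; apply on_edge_seg_pt; exists s; auto. Qed.

Lemma edge_dist_eq0 i p : edge_dist K i p = 0 <-> on_edge K i p.
Proof. apply seg_dist_eq0. Qed.

Lemma edge_dist_ge0 i p : 0 <= edge_dist K i p.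
Proof. apply seg_dist_ge0. Qed.

Lemma edge_point_in_slice i s p : on_edge K i p ->
  pdot (psub p (core_pt i s)) (slice_normal i s) = 0 -> p = core_pt i s.
Proof.
  intros H; apply on_edge_seg_pt in H; destruct H as (t & Ht & ->).
  fold (core_pt i t).
  replace (psub (core_pt i t) (core_pt i s)) with (pscal ((t - s) * edge_len K i) (edge_dir K i)).
  2:{ unfold core_pt; rewrite edge_vec_dir by auto.
      generalize (edge_dir K i), (edge_len K i); unfold seg_pt; vec_eq. }
  rewrite pdot_pscal_l, slice_normal_dir; intros E.
  pose proof (edge_len_gt0 K HK i).
  assert (t - s = 0) by nra; f_equal; lra.
Qed.

Lemma tube_coord_sides w i s p c d : tube_coord w i s p c d ->
  start_side K i p = s * (start_side K i p + end_side K i p) /\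
  0 < start_side K i p + end_side K i p.
Proof.
  intros (Hs & Hd & Hq & _); rewrite slice_dot in Hq.
  split; [lra|]; now apply (sides_sum_gt0 K HK r Hr).
Qed.

Lemma tube_coord_piece w i s p c d : tube_coord w i s p c d -> piece K i r p.
Proof.
  intros H; pose proof (tube_coord_sides _ _ _ _ _ _ H) as [E Hp]; destruct H as (Hs & Hd & _).
  repeat split; auto; nra.
Qed.

Lemma tube_coord_param_unique w i s s' p c d c' d' :
  tube_coord w i s p c d -> tube_coord w i s' p c' d' -> s = s'.
Proof.
  intros H H'; apply tube_coord_sides in H, H'.
  destruct H as [H ?], H' as [H' ?]; apply Rmult_eq_reg_r with (start_side K i p + end_side K i p); lra.
Qed.

(** One vector frames every slice of the whole knot at once, so no twist accumulates around the
    loop. *)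
Definition generic (w : pt3) : Prop := forall i s, pcross w (slice_normal i s) <> (0, 0, 0).

(** All slice normals of an edge are orthogonal to one vector, itself orthogonal to both mitre
    normals. By [pcross_neq0] it suffices that [w] is not orthogonal to any of these [n] vectors. *)
Lemma generic_exists : exists w, generic w.
Proof.
  assert (Hm : forall i, {m | m <> (0, 0, 0) /\ pdot m (mitre K i) = 0 /\ pdot m (mitre K (S i)) = 0})
    by (intros i; apply constructive_indefinite_description, exists_orthogonal2).
  destruct (exists_generic_vector (fun i => proj1_sig (Hm i)) n) as [w Hw].
  { intros i _; apply (proj2_sig (Hm i)). }
  exists w; intros i s.
  assert (E : slice_normal i s = slice_normal (i mod n) s).
  { unfold slice_normal.
    rewrite (mitre_mod K HK (i mod n) i), (mitre_mod K HK (S (i mod n)) (S i)); auto;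
      try apply mod_S_eq; apply Nat.Div0.mod_mod. }
  rewrite E; set (j := (i mod n)%nat).
  destruct (proj2_sig (Hm j)) as (_ & H1 & H2).
  apply (pcross_neq0 _ _ (proj1_sig (Hm j))).
  - intros E'; pose proof (slice_normal_dir j s) as H; rewrite E' in H.
    revert H; generalize (edge_dir K j); intros; coords; lra.
  - unfold slice_normal; expand_dot; rewrite H1, H2; ring.
  - apply Hw, Nat.mod_upper_bound; pose proof (size_ge3 K HK); lia.
Qed.

Lemma slice_coords_eq0 w (Hw : generic w) i s p : pdot (psub p (core_pt i s)) (slice_normal i s) = 0 ->
  pdot w (psub p (core_pt i s)) = 0 ->
  pdot (pcross w (slice_normal i s)) (psub p (core_pt i s)) = 0 -> p = core_pt i s.
Proof. intros; apply psub_eq0, (frame_injective w (slice_normal i s)); auto. Qed.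

Lemma tube_coord_unique w (Hw : generic w) i s p c d c' d' :
  tube_coord w i s p c d -> tube_coord w i s p c' d' -> c = c' /\ d = d'.
Proof.
  intros (Hs & _ & Hq & Hn & Hc & Hp) (_ & _ & _ & Hn' & Hc' & Hp').
  assert (Hrr : 0 < r * r) by nra.
  assert (Hnn : c * c + d * d = c' * c' + d' * d')
    by (apply Rmult_eq_reg_l with (r * r); [congruence|lra]).
  destruct (Req_dec (edge_dist K i p) 0) as [E|E].
  - assert (Z : c * c + d * d = 0)
      by (rewrite E, Rmult_0_l in Hn; apply Rmult_eq_reg_l with (r * r); lra).
    rewrite Z in Hnn; destruct (Rplus_sqr_eq_0 c d Z), (Rplus_sqr_eq_0 c' d' (eq_sym Hnn)); lra.
  - set (x := pdot w (psub p (core_pt i s))) in *.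
    set (y := pdot (pcross w (slice_normal i s)) (psub p (core_pt i s))) in *.
    assert (Hxy : 0 < x * x + y * y).
    { destruct (Req_dec x 0) as [Ex|]; [|nra]; destruct (Req_dec y 0) as [Ey|]; [|nra].
      exfalso; apply E, edge_dist_eq0.
      rewrite (slice_coords_eq0 w Hw i s p Hq Ex Ey); now apply core_pt_on_edge. }
    destruct (same_ray c d x y) as (k & Hk & -> & ->); auto.
    destruct (same_ray c' d' x y) as (k' & Hk' & -> & ->); auto.
    assert (k = k'); [|subst; auto].
    assert (Hkk : (k * k - k' * k') * (x * x + y * y) = 0) by lra.
    apply Rmult_integral in Hkk; destruct Hkk; nra.
Qed.

Lemma edge_dist_shrink i s p t : 0 <= s <= 1 -> 0 <= t <= 1 ->
  edge_dist K i (padd (core_pt i s) (pscal t (psub p (core_pt i s)))) <= t * edge_dist K i p.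
Proof.
  intros Hs Ht.
  replace (padd _ _) with (padd (pscal (1 - t) (core_pt i s)) (pscal t p))
    by (generalize (core_pt i s); vec_eq).
  eapply Rle_trans; [apply seg_dist_convex; auto|].
  fold (edge_dist K i p) (edge_dist K i (core_pt i s)).
  rewrite (proj2 (edge_dist_eq0 i (core_pt i s))) by (now apply core_pt_on_edge); lra.
Qed.

(** Both points lie on one ray from the core point of the slice and have the same distance to the
    edge. By [edge_dist_shrink] the distance cannot repeat a positive value along a ray. *)
Lemma tube_coord_injective w (Hw : generic w) i s p p' c d :
  tube_coord w i s p c d -> tube_coord w i s p' c d -> p = p'.
Proof.
  intros (Hs & _ & Hq & Hn & Hc & Hp) (_ & _ & Hq' & Hn' & Hc' & Hp').
  pose proof (edge_dist_ge0 i p); pose proof (edge_dist_ge0 i p').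
  assert (Hee : edge_dist K i p = edge_dist K i p') by nra.
  destruct (Req_dec (edge_dist K i p) 0) as [E|E].
  - rewrite (edge_point_in_slice i s p), (edge_point_in_slice i s p'); auto;
      apply edge_dist_eq0; congruence.
  - assert (Hcd : 0 < c * c + d * d) by (assert (0 < r * r) by nra; nra).
    destruct (same_ray (pdot w (psub p (core_pt i s)))
      (pdot (pcross w (slice_normal i s)) (psub p (core_pt i s))) c d)
      as (k & Hk & Ex & Ey); [auto|lra|lra|].
    destruct (same_ray (pdot w (psub p' (core_pt i s)))
      (pdot (pcross w (slice_normal i s)) (psub p' (core_pt i s))) c d)
      as (k' & Hk' & Ex' & Ey'); [auto|lra|lra|].
    assert (Hne : forall z, edge_dist K i z = edge_dist K i p -> z <> core_pt i s).
    { intros z Hz Ez; apply E; rewrite <- Hz; apply edge_dist_eq0.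
      rewrite Ez; now apply core_pt_on_edge. }
    assert (Hk0 : k <> 0).
    { intros ->; apply (Hne p); auto; apply (slice_coords_eq0 w Hw); auto; lra. }
    assert (Hk0' : k' <> 0).
    { intros ->; apply (Hne p'); auto; apply (slice_coords_eq0 w Hw); auto; lra. }
    assert (Hprop : pscal k (psub p' (core_pt i s)) = pscal k' (psub p (core_pt i s))).
    { apply psub_eq0, (frame_injective w (slice_normal i s)); auto; expand_dot;
        rewrite ?Hq, ?Hq', ?Ex, ?Ex', ?Ey, ?Ey'; ring. }
    assert (Hscale : forall a b z z', 0 < a -> 0 < b -> a <= b ->
      edge_dist K i z = edge_dist K i p -> edge_dist K i z' = edge_dist K i p ->
      pscal b (psub z' (core_pt i s)) = pscal a (psub z (core_pt i s)) -> a = b).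
    { intros a b z z' Ha Hb Hab Hz Hz' Hpr.
      assert (Hab1 : 0 <= a / b <= 1).
      { split; [apply Rdiv_le_0_compat; lra|apply Rle_div_l; lra]. }
      pose proof (edge_dist_shrink i s z (a / b) Hs Hab1) as Hsh.
      replace (padd (core_pt i s) (pscal (a / b) (psub z (core_pt i s)))) with z' in Hsh.
      2:{ replace (pscal (a / b) (psub z (core_pt i s)))
            with (pscal (/ b) (pscal a (psub z (core_pt i s))))
            by (generalize (core_pt i s); intros; coords; split_pairs; field; lra).
          rewrite <- Hpr; generalize (core_pt i s); intros; coords; split_pairs; field; lra. }
      rewrite Hz, Hz' in Hsh.
      assert (Hab2 : a / b = 1) by nra.
      apply Rmult_eq_reg_r with (/ b); [|apply Rinv_neq_0_compat; lra].
      rewrite Rinv_r by lra; exact Hab2. }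
    assert (Ekk : k = k').
    { destruct (Rle_lt_dec k k').
      - apply (Hscale k k' p' p); auto; lra.
      - symmetry; apply (Hscale k' k p p'); auto; lra. }
    apply psub_eq0; subst k'; revert Hprop; generalize (core_pt i s); intros v Hprop.
    revert Hprop; clear - Hk0; coords; intros E; injection E as E1 E2 E3.
    split_pairs; apply Rmult_eq_reg_l with k; auto; lra.
Qed.

(** The prescribed coordinates fix a ray in the slice; the required distance is found on it by the
    intermediate value theorem. *)
Lemma tube_coord_exists w (Hw : generic w) i s c d : 0 <= s <= 1 -> c * c + d * d <= 1 ->
  exists p, tube_coord w i s p c d.
Proof.
  intros Hs Hcd.
  assert (H0 : 0 <= c * c + d * d) by nra.
  set (v := core_pt i s); set (N := slice_normal i s).
  assert (Hv : edge_dist K i v = 0) by (apply edge_dist_eq0, core_pt_on_edge; auto).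
  destruct (frame_surjective w N c d (Hw i s)) as (q & Hq1 & Hq2 & Hq3).
  assert (Hsub : forall t, psub (padd v (pscal t q)) v = pscal t q) by (intros; vec_eq).
  set (rho := r * sqrt (c * c + d * d)).
  assert (Hrho : 0 <= rho <= r).
  { unfold rho; pose proof (sqrt_pos (c * c + d * d)).
    assert (sqrt (c * c + d * d) <= 1) by (rewrite <- sqrt_1; now apply sqrt_le_1_alt); nra. }
  assert (Hrho2 : rho * rho = r * r * (c * c + d * d)).
  { unfold rho; rewrite <- (sqrt_sqrt (c * c + d * d)) at 3 by auto; ring. }
  assert (Ht : exists t, 0 <= t /\ edge_dist K i (padd v (pscal t q)) = rho).
  { destruct H0 as [H0|H0].
    2:{ exists 0; split; [lra|]; replace (padd v (pscal 0 q)) with v by vec_eq.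
        rewrite Hv; unfold rho; rewrite <- H0, sqrt_0; ring. }
    set (e := edge_dist K i (padd v (pscal 1 q))).
    assert (He : 0 < e).
    { destruct (edge_dist_ge0 i (padd v (pscal 1 q))) as [|He]; auto; exfalso.
      symmetry in He; apply edge_dist_eq0 in He.
      apply (edge_point_in_slice i s) in He.
      - fold v in He; pose proof (Hsub 1) as E; rewrite He in E.
        assert (q = (0, 0, 0)) as Eq.
        { revert E; clear; generalize v; intros; coords; injection E as ? ? ?; split_pairs; lra. }
        rewrite Eq in Hq2, Hq3.
        assert (Ec : c = 0) by (rewrite <- Hq2; vec_eq).
        assert (Ed : d = 0) by (rewrite <- Hq3; generalize (pcross w N); vec_eq).
        rewrite Ec, Ed in H0; lra.
      - fold v N; rewrite Hsub, pdot_pscal_l, Hq1; ring. }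
    (* By convexity the distance at [t1] is at least [t1 * e = e + rho], so the target [rho] has
       been passed. *)
    set (t1 := 1 + rho / e).
    assert (Ht1 : 1 <= t1) by (unfold t1; assert (0 <= rho / e) by (apply Rdiv_le_0_compat; lra); lra).
    assert (Hbig : rho <= edge_dist K i (padd v (pscal t1 q))).
    { assert (Hi : 0 <= / t1 <= 1).
      { split; [apply Rlt_le, Rinv_0_lt_compat; lra|rewrite <- Rinv_1; apply Rinv_le_contravar; lra]. }
      pose proof (edge_dist_shrink i s (padd v (pscal t1 q)) (/ t1) Hs Hi) as Hsh.
      fold v in Hsh; rewrite Hsub in Hsh.
      replace (pscal (/ t1) (pscal t1 q)) with (pscal 1 q) in Hsh
        by (clear - Ht1; coords; split_pairs; field; lra).
      fold e in Hsh; apply Rmult_le_compat_l with (r := t1) in Hsh; [|lra].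
      rewrite <- Rmult_assoc, Rinv_r, Rmult_1_l in Hsh by lra.
      replace (t1 * e) with (e + rho) in Hsh by (unfold t1; field; lra); lra. }
    set (phi := fun t => edge_dist K i (padd v (pscal t q))).
    assert (Hphi0 : phi 0 = 0).
    { unfold phi; replace (padd v (pscal 0 q)) with v by vec_eq; exact Hv. }
    assert (Hcont : continuity phi).
    { intros t eps Heps; pose proof (pnorm_ge0 q) as Hqn.
      exists (eps / (pnorm q + 1)); split; [apply Rdiv_lt_0_compat; lra|].
      intros t' [_ Htt]; simpl in *; unfold R_dist in *.
      assert (E : forall a b, phi a - phi b <= Rabs (a - b) * pnorm q).
      { intros a b; unfold phi.
        pose proof (edge_dist_lipschitz K i (padd v (pscal a q)) (padd v (pscal b q))) as L.
        unfold pdist in L.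
        replace (psub (padd v (pscal a q)) (padd v (pscal b q))) with (pscal (a - b) q) in L by vec_eq.
        rewrite pnorm_pscal in L; lra. }
      pose proof (E t' t) as E1; pose proof (E t t') as E2; rewrite (Rabs_minus_sym t t') in E2.
      apply Rmult_lt_compat_r with (r := pnorm q + 1) in Htt; [|lra].
      unfold Rdiv in Htt; rewrite Rmult_assoc, Rinv_l in Htt by lra.
      pose proof (Rabs_pos (t' - t)); apply Rabs_def1; lra. }
    destruct (IVT_gen phi 0 t1 rho Hcont) as (t & Ht & E).
    { rewrite Hphi0; fold (phi t1) in Hbig.
      rewrite Rmin_left, Rmax_right; lra. }
    exists t; split; [|exact E]; rewrite Rmin_left in Ht; lra. }
  destruct Ht as (t & Ht & E); exists (padd v (pscal t q)); unfold tube_coord.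
  fold v N; rewrite E, Hsub; expand_dot; rewrite Hq1, Hq2, Hq3.
  repeat split; try lra; nra.
Qed.

Lemma slice_normal_1 i : slice_normal i 1 = mitre K (S i).
Proof. unfold slice_normal; generalize (mitre K i), (mitre K (S i)); vec_eq. Qed.

Lemma slice_normal_0 i : slice_normal i 0 = mitre K i.
Proof. unfold slice_normal; generalize (mitre K i), (mitre K (S i)); vec_eq. Qed.

Lemma core_pt_1 i : core_pt i 1 = core_pt (S i) 0.
Proof. unfold core_pt, seg_pt, edge_vec; vec_eq. Qed.

(** At [s = 1] the slice is the mitre section shared with the next edge: core point and normal
    coincide, and [piece_next] equates the two distances. *)
Lemma tube_coord_next w i p c d : tube_coord w i 1 p c d -> tube_coord w (S i) 0 p c d.
Proof.
  intros H; pose proof (tube_coord_piece _ _ _ _ _ _ H) as (Hd & _ & _).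
  pose proof (tube_coord_sides _ _ _ _ _ _ H) as [E _].
  destruct (piece_next K HK r Hr i p) as [Ed _]; [auto|lra|].
  unfold tube_coord in *; rewrite slice_normal_0, <- core_pt_1, Ed.
  rewrite slice_normal_1 in H; intuition lra.
Qed.

Lemma tube_coord_mod w i j s p c d : (i mod n = j mod n)%nat ->
  tube_coord w i s p c d -> tube_coord w j s p c d.
Proof.
  intros E; unfold tube_coord, slice_normal, core_pt.
  rewrite (vtx_mod K _ _ E), (edge_vec_mod K _ _ E), (mitre_mod K HK _ _ E),
    (mitre_mod K HK _ _ (mod_S_eq _ _ _ E)), (edge_dist_mod K _ _ p E); auto.
Qed.

Lemma piece_tube_coord w (Hw : generic w) i p : piece K i r p ->
  exists s c d, tube_coord w i s p c d /\ c * c + d * d <= 1.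
Proof.
  intros (Hd & Ha & Hb); pose proof (sides_sum_gt0 K HK r Hr i p Hd) as Hp.
  set (A := start_side K i p) in *; set (B := end_side K i p) in *.
  (* The solution of the slice equation (1-s)A = sB. *)
  set (s := A / (A + B)).
  assert (Hs : 0 <= s <= 1) by (split; [apply Rdiv_le_0_compat|apply Rle_div_l]; lra).
  assert (Hq : pdot (psub p (core_pt i s)) (slice_normal i s) = 0)
    by (rewrite slice_dot; fold A B; unfold s; field; lra).
  pose proof (edge_dist_ge0 i p) as He.
  set (e := edge_dist K i p) in *.
  set (x := pdot w (psub p (core_pt i s))).
  set (y := pdot (pcross w (slice_normal i s)) (psub p (core_pt i s))).
  destruct (Req_dec e 0) as [E|E].
  - exists s, 0, 0; split; [|lra]; unfold tube_coord; fold e x y; rewrite E in *.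
    repeat split; auto; lra.
  - assert (Hxy : 0 < x * x + y * y).
    { destruct (Req_dec x 0) as [Ex|]; [|nra]; destruct (Req_dec y 0) as [Ey|]; [|nra].
      exfalso; apply E, edge_dist_eq0.
      rewrite (slice_coords_eq0 w Hw i s p Hq Ex Ey); now apply core_pt_on_edge. }
    pose proof (sqrt_lt_R0 _ Hxy) as Hl; pose proof (sqrt_sqrt _ (Rlt_le _ _ Hxy)) as Hl2.
    set (l := sqrt (x * x + y * y)) in *.
    (* Rescales the coordinates [(x, y)], of length [l], to length [e / r]. *)
    set (k := e / (r * l)).
    assert (Hk : 0 <= k) by (apply Rdiv_le_0_compat; [auto|nra]).
    assert (Hkl : k * l * r = e) by (unfold k; field; lra).
    assert (Hn : r * r * (k * x * (k * x) + k * y * (k * y)) = e * e).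
    { rewrite <- Hkl; replace (k * x * (k * x) + k * y * (k * y)) with (k * k * (x * x + y * y)) by ring.
      rewrite <- Hl2; ring. }
    exists s, (k * x), (k * y); split.
    + unfold tube_coord; fold e x y; repeat split; auto; try lra; nra.
    + apply Rmult_le_reg_l with (r * r); [nra|]; rewrite Hn; nra.
Qed.

Lemma tube_coord_closed w i ps ss cs ds p s c d :
  (forall k, tube_coord w i (ss k) (ps k) (cs k) (ds k)) ->
  lim_pt ps p -> is_lim_seq ss (Finite s) -> is_lim_seq cs (Finite c) -> is_lim_seq ds (Finite d) ->
  tube_coord w i s p c d.
Proof.
  intros H Hp Hs Hc Hd.
  assert (Hcore : lim_pt (fun k => core_pt i (ss k)) (core_pt i s)).
  { apply lim_pt_padd; [apply lim_pt_const|]; apply lim_pt_pscal; auto using lim_pt_const. }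
  assert (HN : lim_pt (fun k => slice_normal i (ss k)) (slice_normal i s)).
  { apply lim_pt_padd; apply lim_pt_pscal; auto using lim_pt_const.
    apply is_lim_seq_minus'; auto; apply is_lim_seq_const. }
  assert (Hq : lim_pt (fun k => psub (ps k) (core_pt i (ss k))) (psub p (core_pt i s)))
    by (now apply lim_pt_psub).
  assert (Hx := lim_pt_pdot _ _ _ _ (lim_pt_const w) Hq).
  assert (Hy := lim_pt_pdot _ _ _ _ (lim_pt_pcross _ _ _ _ (lim_pt_const w) HN) Hq).
  assert (He : is_lim_seq (fun k => edge_dist K i (ps k)) (edge_dist K i p))
    by (apply lim_pt_lipschitz; auto using edge_dist_lipschitz).
  unfold tube_coord in *; repeat split.
  - apply (lim_ge_const ss); auto; intros k; apply (H k).
  - apply (lim_le_const ss); auto; intros k; apply (H k).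
  - apply (lim_le_const _ _ _ He); intros k; apply (H k).
  - apply (lim_unique _ (fun _ => 0) _ _ (lim_pt_pdot _ _ _ _ Hq HN)); [apply is_lim_seq_const|].
    intros k; apply (H k).
  - apply (lim_unique (fun k => r * r * (cs k * cs k + ds k * ds k))
      (fun k => edge_dist K i (ps k) * edge_dist K i (ps k))).
    + apply is_lim_seq_mult'; [apply is_lim_seq_const|].
      apply is_lim_seq_plus'; now apply is_lim_seq_mult'.
    + now apply is_lim_seq_mult'.
    + intros k; apply (H k).
  - eapply lim_unique; [apply is_lim_seq_mult'; [exact Hc|exact Hy]|
      apply is_lim_seq_mult'; [exact Hd|exact Hx]|].
    intros k; apply (H k).
  - eapply lim_ge_const; [apply is_lim_seq_plus'; apply is_lim_seq_mult';
      [exact Hc|exact Hx|exact Hd|exact Hy]|].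
    intros k; apply (H k).
Qed.

End Coordinates.

(** * The solid torus *)

Lemma coord_le_dist4 a b c d a' b' c' d' eps : dist4 (a, b, c, d) (a', b', c', d') < eps ->
  Rabs (a' - a) < eps /\ Rabs (b' - b) < eps /\ Rabs (c' - c) < eps /\ Rabs (d' - d) < eps.
Proof.
  assert (H : forall x y, 0 <= y -> Rabs x <= sqrt (x * x + y)).
  { intros x y Hy; rewrite <- sqrt_Rsqr_abs; apply sqrt_le_1_alt; unfold Rsqr; lra. }
  unfold dist4; intros Hd; repeat split; eapply Rle_lt_trans; try exact Hd.
  - replace (_ + _) with ((a' - a) * (a' - a) + ((b - b')^2 + (c - c')^2 + (d - d')^2)) by ring.
    apply H; repeat apply Rplus_le_le_0_compat; apply pow2_ge_0.
  - replace (_ + _) with ((b' - b) * (b' - b) + ((a - a')^2 + (c - c')^2 + (d - d')^2)) by ring.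
    apply H; repeat apply Rplus_le_le_0_compat; apply pow2_ge_0.
  - replace (_ + _) with ((c' - c) * (c' - c) + ((b - b')^2 + (a - a')^2 + (d - d')^2)) by ring.
    apply H; repeat apply Rplus_le_le_0_compat; apply pow2_ge_0.
  - replace (_ + _) with ((d' - d) * (d' - d) + ((b - b')^2 + (c - c')^2 + (a - a')^2)) by ring.
    apply H; repeat apply Rplus_le_le_0_compat; apply pow2_ge_0.
Qed.

Lemma is_lim_seq_inv_bound (u : nat -> R) (l : R) :
  (forall k, Rabs (u k - l) < / (INR k + 1)) -> is_lim_seq u l.
Proof.
  intros H; apply is_lim_seq_spec; intros eps.
  destruct (archimed_cor1 eps (cond_pos eps)) as (N & HN & HN0).
  exists N; intros k Hk; eapply Rlt_trans; [apply H|]; eapply Rle_lt_trans; [|apply HN].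
  apply Rinv_le_contravar; [now apply lt_0_INR|].
  apply le_INR in Hk; lra.
Qed.

Section Torus.
Context (K : polyknot) (HK : is_polyknot K) (r : R) (Hr0 : 0 < r) (Hr : Rbar_lt r (MinRad K))
  (Hd : Rbar_lt r (Rbar_mult (/ 2) (dcsd K))) (w : pt3) (Hw : generic K w).
Local Notation n := (pk_n K).

Definition knot_angle (i : nat) (s : R) : R := 2 * PI * ((INR i + s) / INR n).

(** A relation, because a point of a mitre section has two descriptions: [s = 1] on one edge and
    [s = 0] on the next. *)
Definition torus_graph (P : pt4) (p : pt3) : Prop :=
  let '(a, b, c, d) := P in exists i s, (i < n)%nat /\ tube_coord K r w i s p c d /\
    a = cos (knot_angle i s) /\ b = sin (knot_angle i s).

Lemma size_gt0 : 0 < INR n.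
Proof. apply lt_0_INR; pose proof (size_ge3 K HK); lia. Qed.

(** Equal angles differ by a multiple of the full turn, and [INR i + s] stays in [0,n], so the
    multiple is -1, 0 or 1. The extreme values pair the end of the last edge with the start of edge
    0. *)
Lemma knot_angle_eq i s i' s' : (i < n)%nat -> (i' < n)%nat -> 0 <= s <= 1 -> 0 <= s' <= 1 ->
  cos (knot_angle i s) = cos (knot_angle i' s') ->
  sin (knot_angle i s) = sin (knot_angle i' s') ->
  i = i' /\ s = s' \/
  (S i mod n = i' mod n)%nat /\ s = 1 /\ s' = 0 \/
  (i mod n = S i' mod n)%nat /\ s = 0 /\ s' = 1.
Proof.
  intros Hi Hi' Hs Hs' Hc Hsin; destruct (cos_sin_eq _ _ Hc Hsin) as [k Hk].
  pose proof size_gt0 as Hn; pose proof PI_RGT_0 as Hpi.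
  assert (E : INR i + s - (INR i' + s') = IZR k * INR n).
  { unfold knot_angle in Hk.
    apply Rmult_eq_reg_l with (2 * PI / INR n); [|apply Rgt_not_eq, Rdiv_lt_0_compat; lra].
    replace (2 * PI / INR n * (IZR k * INR n)) with (IZR k * (2 * PI)) by (field; lra).
    rewrite <- Hk; field; lra. }
  assert (Bi : 0 <= INR i <= INR n - 1).
  { split; [apply pos_INR|]; apply le_INR in Hi; rewrite S_INR in Hi; lra. }
  assert (Bi' : 0 <= INR i' <= INR n - 1).
  { split; [apply pos_INR|]; apply le_INR in Hi'; rewrite S_INR in Hi'; lra. }
  assert (Hnn : forall a b, INR a + 1 = INR b -> (S a = b)%nat)
    by (intros a b H; apply INR_eq; rewrite S_INR; auto).
  assert (Hk1 : (-2 < k)%Z) by (apply lt_IZR; nra).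
  assert (Hk2 : (k < 2)%Z) by (apply lt_IZR; nra).
  assert (k = -1 \/ k = 0 \/ k = 1)%Z as [-> |[-> | ->]] by lia.
  - right; right.
    assert (i = 0%nat) as -> by (apply INR_eq; simpl; lra).
    assert (S i' = n) as -> by (apply Hnn; simpl in *; lra).
    simpl in *; rewrite Nat.Div0.mod_same, Nat.Div0.mod_0_l; repeat split; lra.
  - destruct (Nat.lt_trichotomy i i') as [H|[->|H]].
    + apply le_INR in H; rewrite S_INR in H; right; left.
      rewrite (Hnn i i'); [repeat split; lra|lra].
    + left; split; [auto|lra].
    + apply le_INR in H; rewrite S_INR in H; right; right.
      rewrite (Hnn i' i); [repeat split; lra|lra].
  - right; left.
    assert (i' = 0%nat) as -> by (apply INR_eq; simpl; lra).
    assert (S i = n) as -> by (apply Hnn; simpl in *; lra).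
    simpl in *; rewrite Nat.Div0.mod_same, Nat.Div0.mod_0_l; repeat split; lra.
Qed.

Lemma knot_angle_next i j : (S i mod n = j mod n)%nat -> (i < n)%nat -> (j < n)%nat ->
  cos (knot_angle i 1) = cos (knot_angle j 0) /\ sin (knot_angle i 1) = sin (knot_angle j 0).
Proof.
  intros E Hi Hj; pose proof size_gt0 as Hn.
  destruct (Nat.eq_dec (S i) n) as [H|H].
  - rewrite H, Nat.Div0.mod_same, Nat.mod_small in E by auto; subst j.
    assert (E1 : knot_angle i 1 = 2 * PI).
    { unfold knot_angle; rewrite <- H, S_INR in *; field; lra. }
    assert (E2 : knot_angle 0 0 = 0) by (unfold knot_angle; simpl INR; field; lra).
    rewrite E1, E2, cos_2PI, sin_2PI, cos_0, sin_0; auto.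
  - rewrite !Nat.mod_small in E by lia; subst j.
    unfold knot_angle; rewrite S_INR; rewrite Rplus_0_r; auto.
Qed.

(** This gives injectivity of the embedding and is where the bound by [dcsd] enters: two pieces
    containing [p] are equal or adjacent. In the adjacent case [p] lies on their mitre section,
    which forces [s = 1] and [s' = 0]. *)
Lemma torus_graph_functional P P' p : torus_graph P p -> torus_graph P' p -> P = P'.
Proof.
  destruct P as [[[a b] c] d], P' as [[[a' b'] c'] d'].
  assert (next : forall i s j s' c d c' d', (S i mod n = j mod n)%nat -> (i < n)%nat -> (j < n)%nat ->
     tube_coord K r w i s p c d -> tube_coord K r w j s' p c' d' ->
     c = c' /\ d = d' /\ cos (knot_angle i s) = cos (knot_angle j s') /\
     sin (knot_angle i s) = sin (knot_angle j s')).
  { clear - HK Hr0 Hr Hw; intros i s j s' c d c' d' E Hi Hj H H'.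
    apply (tube_coord_mod K HK r w j (S i)) in H'; auto.
    pose proof (tube_coord_sides K HK r Hr _ _ _ _ _ _ H) as [E1 E1'].
    pose proof (tube_coord_sides K HK r Hr _ _ _ _ _ _ H') as [E2 E2'].
    destruct (pieces_meet_end K r i p) as [E3 E4]; auto;
      [eapply tube_coord_piece; eauto..|].
    assert (s = 1) as ->.
    { rewrite E3 in *; apply Rmult_eq_reg_r with (start_side K i p); lra. }
    assert (s' = 0) as ->.
    { rewrite E4 in *; symmetry in E2; apply Rmult_integral in E2; destruct E2; lra. }
    apply (tube_coord_next K HK r Hr) in H.
    destruct (tube_coord_unique K r Hr0 w Hw _ _ _ _ _ _ _ H H') as [-> ->].
    destruct (knot_angle_next i j E Hi Hj); auto. }
  intros (i & s & Hi & H & -> & ->) (i' & s' & Hi' & H' & -> & ->).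
  destruct (far_pieces_disjoint K HK r Hr i i' p) as [E|[E|E]]; auto;
    try (eapply tube_coord_piece; eauto).
  - rewrite !Nat.mod_small in E by auto; subst i'.
    pose proof (tube_coord_param_unique K HK r Hr _ _ _ _ _ _ _ _ _ H H') as Es; subst s'.
    destruct (tube_coord_unique K r Hr0 w Hw _ _ _ _ _ _ _ H H') as [-> ->]; auto.
  - destruct (next _ _ _ _ _ _ _ _ E Hi Hi' H H') as (-> & -> & -> & ->); auto.
  - destruct (next _ _ _ _ _ _ _ _ (eq_sym E) Hi' Hi H' H) as (-> & -> & -> & ->); auto.
Qed.

Lemma torus_graph_injective P p p' : torus_graph P p -> torus_graph P p' -> p = p'.
Proof.
  destruct P as [[[a b] c] d].
  assert (next : forall i j p p' c d, (S i mod n = j mod n)%nat ->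
     tube_coord K r w i 1 p c d -> tube_coord K r w j 0 p' c d -> p = p').
  { clear - HK Hr0 Hr Hw; intros i j p p' c d E H H'.
    apply (tube_coord_mod K HK r w j (S i)) in H'; auto.
    apply (tube_coord_next K HK r Hr) in H.
    eapply (tube_coord_injective K HK r Hr0 w Hw); eauto. }
  intros (i & s & Hi & H & -> & ->) (i' & s' & Hi' & H' & E1 & E2).
  pose proof H as (Hs & _); pose proof H' as (Hs' & _).
  destruct (knot_angle_eq i s i' s') as [[-> ->]|[(E & -> & ->)|(E & -> & ->)]]; auto.
  - eapply (tube_coord_injective K HK r Hr0 w Hw); eauto.
  - exact (next _ _ _ _ _ _ E H H').
  - symmetry; exact (next _ _ _ _ _ _ (eq_sym E) H' H).
Qed.

Lemma torus_graph_total P : in_solid_torus P -> exists p, torus_graph P p.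
Proof.
  destruct P as [[[a b] c] d]; intros [Hab Hcd]; pose proof size_gt0 as Hn.
  destruct (circle_angle a b Hab) as (t & Ht & Ha & Hb).
  pose proof PI_RGT_0 as Hpi.
  destruct (nat_plus_fraction (INR n * t / (2 * PI)) n) as (i & s & Hi & Hs & E).
  - apply INR_lt; exact Hn.
  - split; [apply Rdiv_le_0_compat; [apply Rmult_le_pos; lra|lra]|].
    apply Rle_div_l; [lra|]; apply Rmult_le_compat_l; lra.
  - assert (Et : knot_angle i s = t) by (unfold knot_angle; rewrite <- E; field; lra).
    destruct (tube_coord_exists K HK r Hr0 w Hw i s c d Hs Hcd) as [p Hp].
    exists p, i, s; rewrite Et; auto.
Qed.

Lemma torus_graph_Tube P p : torus_graph P p -> Tube K r p.
Proof.
  destruct P as [[[a b] c] d]; intros (i & s & Hi & H & _).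
  apply (Tube_piece K HK r Hr); exists i; eapply tube_coord_piece; eauto.
Qed.

Lemma Tube_torus_graph p : Tube K r p -> exists P, in_solid_torus P /\ torus_graph P p.
Proof.
  intros H; apply (Tube_piece K HK r Hr) in H; destruct H as [i0 H].
  set (i := (i0 mod n)%nat).
  assert (Hi : (i < n)%nat) by (apply Nat.mod_upper_bound; pose proof (size_ge3 K HK); lia).
  apply (piece_mod K HK i0 i) in H; [|symmetry; apply Nat.Div0.mod_mod].
  destruct (piece_tube_coord K HK r Hr0 Hr w Hw i p H) as (s & c & d & Hp & Hcd).
  exists (cos (knot_angle i s), sin (knot_angle i s), c, d); split; [split|].
  - pose proof (sin2_cos2 (knot_angle i s)); unfold Rsqr in *; lra.
  - auto.
  - exists i, s; auto.
Qed.

Lemma torus_graph_core_on_knot a b p : torus_graph (a, b, 0, 0) p -> on_knot K p.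
Proof.
  intros (i & s & Hi & (Hs & _ & _ & Hn & _) & _); exists i; split; auto.
  apply edge_dist_eq0; replace (r * r * (0 * 0 + 0 * 0)) with 0 in Hn by ring.
  symmetry in Hn; apply Rmult_integral in Hn; tauto.
Qed.

Lemma on_knot_torus_graph p : on_knot K p ->
  exists a b, a * a + b * b = 1 /\ torus_graph (a, b, 0, 0) p.
Proof.
  intros (i & Hi & H); pose proof H as H0; apply edge_dist_eq0 in H0.
  apply on_edge_seg_pt in H; destruct H as (s & Hs & E); fold (core_pt K i s) in E.
  exists (cos (knot_angle i s)), (sin (knot_angle i s)); split.
  - pose proof (sin2_cos2 (knot_angle i s)); unfold Rsqr in *; lra.
  - exists i, s; split; [auto|split; auto].
    unfold tube_coord; rewrite H0, <- E.
    assert (Z : forall v, pdot (psub p p) v = 0) by (clear; intros; vec_eq).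
    rewrite !(pdot_comm _ (psub p p)), !Z; repeat split; lra.
Qed.

(** Otherwise there are torus points tending to [P] whose images stay [eps] away from [p]. The
    images are bounded, so a subsequence converges; its limit is related to [P] by closedness, hence
    equals [p]. Fixing the edge lets the parameters [s] converge too. *)
Lemma torus_graph_continuous_edge i P p eps : (i < n)%nat -> torus_graph P p -> 0 < eps ->
  exists delta, 0 < delta /\ forall Q, dist4 P Q < delta ->
    let '(a, b, c, d) := Q in forall q s, tube_coord K r w i s q c d ->
      a = cos (knot_angle i s) -> b = sin (knot_angle i s) -> pdist p q < eps.
Proof.
  intros Hi HP Heps; apply NNPP; intros Hno.
  destruct P as [[[a0 b0] c0] d0].
  assert (Hseq : forall k : nat, {z : R * R * R * pt3 |
    let '(s, c, d, q) := z in tube_coord K r w i s q c d /\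
      dist4 (a0, b0, c0, d0) (cos (knot_angle i s), sin (knot_angle i s), c, d) < / (INR k + 1) /\
      eps <= pdist p q}).
  { intros k; apply constructive_indefinite_description, NNPP; intros Hk; apply Hno.
    exists (/ (INR k + 1)); split; [apply Rinv_0_lt_compat; pose proof (pos_INR k); lra|].
    intros [[[a b] c] d] HQ q s Hq Ea Eb; apply Rnot_le_lt; intros Hle; apply Hk.
    exists (s, c, d, q); subst a b; auto. }
  set (z := fun k => proj1_sig (Hseq k)).
  set (ss := fun k => fst (fst (fst (z k)))); set (cs := fun k => snd (fst (fst (z k)))).
  set (ds := fun k => snd (fst (z k))); set (qs := fun k => snd (z k)).
  assert (Hz : forall k, tube_coord K r w i (ss k) (qs k) (cs k) (ds k) /\
    dist4 (a0, b0, c0, d0) (cos (knot_angle i (ss k)), sin (knot_angle i (ss k)), cs k, ds k)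
      < / (INR k + 1) /\ eps <= pdist p (qs k)).
  { intros k; unfold ss, cs, ds, qs, z; destruct (Hseq k) as [[[[s c] d] q] H]; exact H. }
  clearbody ss cs ds qs; clear z Hseq Hno.
  destruct (bounded_subsequence_pt qs (r + (edge_len K i + pnorm (vtx K i)))) as (f & l & Hf & Hl).
  { intros k; destruct (Hz k) as [(_ & H & _) _]; pose proof (pnorm_le_edge_dist K HK i (qs k)); lra. }
  destruct (bounded_subsequence (fun k => ss (f k)) 1) as (g & s & Hg & Hs).
  { intros k; destruct (Hz (f k)) as [(H & _) _]; apply Rabs_le_between; lra. }
  set (h := fun k => f (g k)).
  assert (Hh : forall k, (h k < h (S k))%nat).
  { assert (mono : forall a b, (a < b)%nat -> (f a < f b)%nat)
      by (intros a b Hab; induction Hab; [apply Hf|specialize (Hf m); lia]).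
    intros k; apply mono, Hg. }
  assert (Hlh : lim_pt (fun k => qs (h k)) l).
  { destruct Hl as (H1 & H2 & H3); split; [|split];
      [exact (is_lim_seq_sub (fun k => pX (qs (f k))) g _ Hg H1)
      |exact (is_lim_seq_sub (fun k => pY (qs (f k))) g _ Hg H2)
      |exact (is_lim_seq_sub (fun k => pZ (qs (f k))) g _ Hg H3)]. }
  assert (Hlim : forall (u : nat -> R) (x : R), (forall k, Rabs (u k - x) < / (INR k + 1)) ->
     is_lim_seq (fun k => u (h k)) x).
  { intros u x H; apply (is_lim_seq_sub u h); auto; now apply is_lim_seq_inv_bound. }
  assert (Hcoord := fun k => coord_le_dist4 _ _ _ _ _ _ _ _ _ (proj1 (proj2 (Hz k)))).
  assert (Hang : is_lim_seq (fun k => knot_angle i (ss (h k))) (knot_angle i s)).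
  { unfold knot_angle, Rdiv; apply is_lim_seq_mult'; [apply is_lim_seq_const|].
    apply is_lim_seq_mult'; [|apply is_lim_seq_const].
    apply is_lim_seq_plus'; [apply is_lim_seq_const|exact Hs]. }
  assert (Hgr : torus_graph (a0, b0, c0, d0) l).
  { exists i, s; split; [auto|split; [|split]].
    - apply (tube_coord_closed K r w i (fun k => qs (h k)) (fun k => ss (h k))
        (fun k => cs (h k)) (fun k => ds (h k))); auto.
      + intros k; apply Hz.
      + apply Hlim; intros k; apply (Hcoord k).
      + apply Hlim; intros k; apply (Hcoord k).
    - apply (lim_unique (fun k => cos (knot_angle i (ss (h k)))) (fun k => cos (knot_angle i (ss (h k)))));
        auto.
      + apply (Hlim (fun k => cos (knot_angle i (ss k)))); intros k; apply (Hcoord k).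
      + apply (is_lim_seq_continuous cos); auto; apply continuity_cos.
    - apply (lim_unique (fun k => sin (knot_angle i (ss (h k)))) (fun k => sin (knot_angle i (ss (h k)))));
        auto.
      + apply (Hlim (fun k => sin (knot_angle i (ss k)))); intros k; apply (Hcoord k).
      + apply (is_lim_seq_continuous sin); auto; apply continuity_sin. }
  assert (p = l) as -> by (eapply torus_graph_injective; eauto).
  apply lim_pt_pdist in Hlh.
  assert (eps <= 0); [|lra].
  apply (lim_ge_const _ _ _ Hlh); intros k; rewrite pdist_sym; apply Hz.
Qed.

Lemma torus_graph_continuous P p eps : torus_graph P p -> 0 < eps ->
  exists delta, 0 < delta /\ forall Q q, dist4 P Q < delta -> torus_graph Q q -> pdist p q < eps.
Proof.
  intros HP Heps.
  destruct (finite_common_delta (fun i delta => forall Q, dist4 P Q < delta ->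
    let '(a, b, c, d) := Q in forall q s, tube_coord K r w i s q c d ->
      a = cos (knot_angle i s) -> b = sin (knot_angle i s) -> pdist p q < eps) n)
    as (delta & Hdelta & H).
  - intros i a b Hb Ha Q HQ; apply Ha; lra.
  - intros i Hi; now apply torus_graph_continuous_edge.
  - exists delta; split; auto; intros [[[a b] c] d] q HQ (i & s & Hi & Hq & Ea & Eb).
    exact (H i Hi _ HQ q s Hq Ea Eb).
Qed.

Lemma Tube_embedded_torus : embedded_torus_with_core (Tube K r) (on_knot K).
Proof.
  (* The graph is total on the solid torus, so [epsilon] selects its unique value there. *)
  set (f := fun P => epsilon (inhabits (0, 0, 0)) (torus_graph P)).
  assert (Hf : forall P, in_solid_torus P -> torus_graph P (f P)).
  { intros P HP; apply epsilon_spec, torus_graph_total, HP. }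
  exists f; split; [|split; [|split]].
  - intros P HP eps Heps.
    destruct (torus_graph_continuous P (f P) eps (Hf P HP) Heps) as (delta & Hdelta & H).
    exists delta; split; [auto|]; intros Q HQ HPQ; apply (H Q (f Q) HPQ), Hf, HQ.
  - intros P Q HP HQ E; apply (torus_graph_functional P Q (f P)); auto.
    rewrite E; auto.
  - intros y; split.
    + intros Hy; apply Tube_torus_graph in Hy; destruct Hy as (P & HP & Hg).
      exists P; split; auto; apply (torus_graph_injective P); auto.
    + intros (P & HP & <-); apply (torus_graph_Tube P); auto.
  - assert (Hcore : forall a b, a * a + b * b = 1 -> in_solid_torus (a, b, 0, 0))
      by (intros a b E; split; lra).
    intros y; split.
    + intros Hy; apply on_knot_torus_graph in Hy; destruct Hy as (a & b & E & Hg).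
      exists a, b; split; auto; apply (torus_graph_injective (a, b, 0, 0)); auto.
    + intros (a & b & E & <-); apply (torus_graph_core_on_knot a b); auto.
Qed.

End Torus.

Theorem theorem7p1 (K : polyknot) (r : R) :
  is_polyknot K -> 0 < r -> Rbar_lt (Finite r) (thick_R K) ->
  embedded_torus_with_core (Tube K r) (on_knot K).
Proof.
  intros HK Hr0 Hr; apply Rbar_lt_min in Hr; destruct Hr as [Hr Hd].
  destruct (generic_exists K HK) as [w Hw].
  now apply (Tube_embedded_torus K HK r Hr0 Hr Hd w).
Qed.
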